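(* Let $k\ge 3$ be a fixed integer and let $p=p(n)\in[0,1]$ satisfy $p\gg n^{-(k-2)}\log n$ and $1-p\gg n^{-(k-2)}\log n$. Then there exists an $O(n^{2k})$ time algorithm that, with high probability, finds a canonical labeling for the random hypergraph $H_{n,p;k}$.
   Context: A hypergraph is $k$-uniform if all of its edges have size $k$. $H_{n,p;k}$ denotes the random $k$-uniform hypergraph on vertex set $[n]=\{1,\dots,n\}$ in which each of the possible edges in $\binom{[n]}{k}$ occurs independently with probability $p$. The notation $A_n\gg B_n$ means $A_n/B_n\to\infty$ as $n\to\infty$. A sequence of events $\mathcal{E}_n$ occurs with high probability (w.h.p.) if $\lim_{n\to\infty}\mathbb{P}(\mathcal{E}_n)=1$. Two $k$-uniform hypergraphs $H_1,H_2$ are isomorphic if there is a bijection $f:V(H_1)\to V(H_2)$ such that $\{x_1,\dots,x_k\}$ is an edge of $H_1$ if and only if $\{f(x_1),\dots,f(x_k)\}$ is an edge of $H_2$. Canonical labeling: in a canonical labeling we assign a unique label to each vertex of the hypergraph (distinct vertices receive distinct labels) such that labels are invariant under isomorphism (if $f:H\to H'$ is an isomorphism then the label of $v$ in $H$ equals the label of $f(v)$ in $H'$, for every vertex $v$). The algorithm is a deterministic algorithm whose input is a $k$-uniform hypergraph on $[n]$; it is allowed to fail (report that no labeling was found) on some inputs. The theorem asserts that on the random input $H_{n,p;k}$ it w.h.p. succeeds in producing such a labeling within $O(n^{2k})$ steps. *)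

(* Defs.v *)
From HB Require Import structures.
From mathcomp Require Import all_boot all_order all_algebra.
From mathcomp Require Import all_classical all_reals all_analysis.

Set Implicit Arguments.
Unset Strict Implicit.
Unset Printing Implicit Defensive.

Import Order.TTheory GRing.Theory Num.Theory.
Import numFieldNormedType.Exports.

(** The vertex set [n] = {1, ..., n} is represented by ['I_n] = {0, ..., n-1}. *)

Record hypergraph (k n : nat) := Hypergraph {
  edges : {set {set 'I_n}};
  edges_uniform : [forall e in edges, #|e| == k] }.

HB.instance Definition _ k n := [isSub for @edges k n].
HB.instance Definition _ k n := [Finite of hypergraph k n by <:].

Definition isomorphism k n (H1 H2 : hypergraph k n) (f : 'I_n -> 'I_n) : Prop :=
  bijective f /\
  forall e : {set 'I_n}, #|e| = k -> (e \in edges H1) = (f @: e \in edges H2).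

Section Asymptotics.
Local Open Scope ring_scope.
Local Open Scope classical_set_scope.
Variable R : realType.

Definition Hnp_mass k n (p : R) (H : hypergraph k n) : R :=
  \prod_(e : {set 'I_n} | #|e| == k) (if e \in edges H then p else 1 - p).

Definition Hnp_prob k n (p : R) (E : pred (hypergraph k n)) : R :=
  \sum_(H : hypergraph k n | E H) Hnp_mass p H.

Definition whp k (p : nat -> R) (E : forall n, pred (hypergraph k n)) : Prop :=
  (fun n => Hnp_prob (p n) (E n)) @ \oo --> (1 : R).

Definition much_greater (A B : nat -> R) : Prop :=
  (fun n => A n / B n) @ \oo --> +oo.

End Asymptotics.

(** A labeling procedure is a partial function; [None] means that it reports
    failure.  *)
Definition labeler (k : nat) :=
  forall n, hypergraph k n -> option {ffun 'I_n -> nat}.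

(** In particular the class of hypergraphs that get labeled is closed under
    isomorphism. *)
Definition canonical_labeler k (lab : labeler k) : Prop :=
  forall n (H : hypergraph k n) (L : {ffun 'I_n -> nat}), lab n H = Some L ->
    injective L /\
    forall (H' : hypergraph k n) (f : 'I_n -> 'I_n), isomorphism H H' f ->
      exists2 L', lab n H' = Some L' & forall v, L v = L' (f v).

(** A word RAM, presented as a while language over finitely many arrays of
    words.  The name of an array is a constant of the program text; a scalar
    variable is cell 0 of an array. *)
Inductive binop := Add | Sub | Mul | Div | Mod | Eq | Lt.

Inductive expr :=
  | Cst (c : nat)
  | Get (a : nat) (i : expr)
  | Bin (o : binop) (e1 e2 : expr).

Inductive cmd :=
  | Skip
  | Assign (a : nat) (i e : expr)
  | Seq (c1 c2 : cmd)
  | If (e : expr) (c1 c2 : cmd)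
  | While (e : expr) (c : cmd).

Definition store := nat -> nat -> nat.

Definition update (s : store) (a i v : nat) : store :=
  fun b j => if (b == a) && (j == i) then v else s b j.

Definition eval_op (o : binop) (x y : nat) : nat :=
  match o with
  | Add => x + y
  | Sub => x - y
  | Mul => x * y
  | Div => x %/ y
  | Mod => x %% y
  | Eq => x == y
  | Lt => x < y
  end.

Fixpoint eval (s : store) (e : expr) : nat :=
  match e with
  | Cst c => c
  | Get a i => s a (eval s i)
  | Bin o e1 e2 => eval_op o (eval s e1) (eval s e2)
  end.

(** Every intermediate value, addresses included, is a word, i.e. at most [W]. *)
Fixpoint fits (W : nat) (s : store) (e : expr) : bool :=
  (eval s e <= W) &&
  match e with
  | Cst _ => true
  | Get _ i => fits W s i
  | Bin _ e1 e2 => fits W s e1 && fits W s e2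
  end.

(** One step per operation. *)
Fixpoint ecost (e : expr) : nat :=
  match e with
  | Cst _ => 1
  | Get _ i => (ecost i).+1
  | Bin _ e1 e2 => (ecost e1 + ecost e2).+1
  end.

(** [exec W c s t s']: from the store [s], the program [c] halts after exactly
    [t] steps in the store [s'].  A program that overflows a word is stuck. *)
Inductive exec (W : nat) : cmd -> store -> nat -> store -> Prop :=
  | exec_Skip s : exec W Skip s 1 s
  | exec_Assign a i e s : fits W s i -> fits W s e ->
      exec W (Assign a i e) s (ecost i + ecost e).+1
        (update s a (eval s i) (eval s e))
  | exec_Seq c1 c2 s1 s2 s3 t1 t2 :
      exec W c1 s1 t1 s2 -> exec W c2 s2 t2 s3 ->
      exec W (Seq c1 c2) s1 (t1 + t2) s3
  | exec_If e c1 c2 s s' t : fits W s e ->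
      exec W (if eval s e != 0 then c1 else c2) s t s' ->
      exec W (If e c1 c2) s (ecost e + t).+1 s'
  | exec_WhileF e c s : fits W s e -> eval s e = 0 ->
      exec W (While e c) s (ecost e).+1 s
  | exec_WhileT e c s1 s2 s3 t1 t2 : fits W s1 e -> eval s1 e != 0 ->
      exec W c s1 t1 s2 -> exec W (While e c) s2 t2 s3 ->
      exec W (While e c) s1 (ecost e + t1 + t2).+1 s3.

Lemma exec_det W c s t1 s1 t2 s2 :
  exec W c s t1 s1 -> exec W c s t2 s2 -> t1 = t2 /\ s1 = s2.
Proof.
move=> ex1; elim: ex1 t2 s2 => {c s t1 s1}.
- by move=> s t2 s2 ex2; inversion ex2.
- by move=> a i e s _ _ t2 s2 ex2; inversion ex2.
- move=> c1 c2 s1 s2 s3 t1 t2 _ IH1 _ IH2 t s ex.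
  inversion ex as [| |? ? ? ? ? ? ? ex1 ex2| | |]; subst.
  by have [? ?] := IH1 _ _ ex1; subst; have [-> ->] := IH2 _ _ ex2.
- move=> e c1 c2 s s' t _ _ IH t2 s2 ex.
  inversion ex as [| | |? ? ? ? ? ? _ ex1| |]; subst.
  by have [-> ->] := IH _ _ ex1.
- move=> e c s _ e0 t2 s2 ex.
  inversion ex as [| | | | |? ? ? ? ? ? ? _ ne0]; subst => //.
  by rewrite e0 in ne0.
- move=> e c s1 s2 s3 t1 t2 _ ne0 _ IH1 _ IH2 t s ex.
  inversion ex as [| | | |? ? ? _ e0|? ? ? ? ? ? ? _ _ ex1 ex2]; subst.
    by rewrite e0 in ne0.
  by have [? ?] := IH1 _ _ ex1; subst; have [-> ->] := IH2 _ _ ex2.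
Qed.

(** The set of the [k] base-[n] digits of [j]. *)
Definition digit_set (k n j : nat) : {set 'I_n} :=
  [set v : 'I_n | [exists i : 'I_k, j %/ n ^ i %% n == v :> nat]].

(** Array 0 holds [n]; array 1 holds the adjacency tensor of [H], with n^k
    entries in {0,1}: the entry indexed by (x_0, ..., x_(k-1)) is at address
    \sum_i x_i n^i.  All other cells are 0. *)
Definition input k n (H : hypergraph k n) : store := fun a j =>
  match a with
  | 0 => if j == 0 then n else 0
  | 1 => (j < n ^ k) && (digit_set k n j \in edges H)
  | _ => 0
  end.

(** On success cell 0 of array 2 is nonzero and array 3 lists the labels. *)
Definition output n (s : store) : option {ffun 'I_n -> nat} :=
  if s 2 0 != 0 then Some [ffun v : 'I_n => s 3 v] else None.

(** A single program serves all [n], on words of O(log n) bits, and the time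
    bound O(T(n)) is for the worst case. *)
Definition computable_in_time k (lab : labeler k) (T : nat -> nat) : Prop :=
  exists (prog : cmd) (w C : nat),
    forall n (H : hypergraph k n), 0 < n ->
      exists t s', [/\ exec (n.+1 ^ w) prog (input H) t s',
                       output n s' = lab n H & t <= C * T n].

(* Main.v *)
(** Colour refinement, one counter at a time, ends with a colouring such that
    any two vertices [v], [w] of the same colour lie in equally many edges
    towards each colour class; it fails only if this equitable partition is not
    discrete.  So it suffices that w.h.p. [H_{n,p;k}] has no other equitable
    partition than the discrete one, which is a union bound over partitions.

    Consider a partition with [r] classes and [m = n - r] vertices that are not
    the chosen representative of their class.  One finds at least [m/4] such
    vertices [v], at least [(r+1)/16] classes [a] with an element [u_a], and a
    set [B] of at least [n/8] vertices, so that the edges [{v, u_a} + e'] with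
    [e'] inside [B] influence, among the equations "[v] and its representative
    have the same count towards [a]", only the one of [(v, a)].  Each block has
    of order [n^(k-2)] potential edges, so its edge count is a binomial variable
    whose variance tends to infinity, and every equation holds with conditional
    probability at most [8^(-64)], say.  Hence the partition is equitable with
    probability at most [8^(-m(r+1))].  There are at most
    [C(n,r) r^m <= (4 r^2)^m] such partitions, and the sum over [r < n] is at
    most [n 2^(-n)]. *)
Require Import Defs.
From HB Require Import structures.
From mathcomp Require Import all_boot all_order all_algebra.
From mathcomp Require Import all_classical all_reals all_analysis.
From mathcomp Require Import zify ring lra.
(* Re-imported because [all_classical] and [all_analysis] shadow some of their names. *)
From mathcomp Require Import ssrfun fintype finset bigop.
Require Import Defs.

Set Implicit Arguments.
Unset Strict Implicit.
Unset Printing Implicit Defensive.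

Import Order.TTheory GRing.Theory Num.Theory.
Import numFieldNormedType.Exports.
Local Open Scope ring_scope.

(** * Binomial point masses *)

Section BinomialMass.
Variable R : realFieldType.
Implicit Types (p : R) (N a L : nat).

Definition pmf N p a : R := 'C(N, a)%:R * p ^+ a * (1 - p) ^+ (N - a).

Lemma pmf_ge0 N p a : 0 <= p <= 1 -> 0 <= pmf N p a.
Proof.
move=> /andP[p0 p1]; rewrite /pmf !mulr_ge0 ?exprn_ge0 ?ler0n //; lra.
Qed.

Lemma pmf_small N p a : (N < a)%N -> pmf N p a = 0.
Proof. by move=> Na; rewrite /pmf bin_small // !mul0r. Qed.

Lemma sum_pmf N p : \sum_(a < N.+1) pmf N p a = 1.
Proof.
have -> : 1 = ((1 - p) + p) ^+ N by rewrite subrK expr1n.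
by rewrite exprDn; apply: eq_bigr => i _; rewrite /pmf -mulr_natl; ring.
Qed.

Lemma sum_pmf_le1 N p M : 0 <= p <= 1 -> \sum_(a < M) pmf N p a <= 1.
Proof.
move=> p01; have [MN|NM] := leqP M N.+1.
  rewrite -(sum_pmf N p) -(big_mkord xpredT (pmf N p)).
  rewrite -(big_mkord xpredT (pmf N p)) (big_cat_nat _ MN) //=.
  by rewrite lerDl sumr_ge0 // => i _; exact: pmf_ge0.
rewrite -(big_mkord xpredT (pmf N p)) (big_cat_nat _ (ltnW NM)) //=.
rewrite big_mkord sum_pmf gerDl big_nat_cond big1 // => i /andP[/andP[Ni _] _].
by rewrite pmf_small.
Qed.

Lemma pmf_sym N p a : (a <= N)%N -> pmf N p a = pmf N (1 - p) (N - a).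
Proof.
move=> aN; rewrite /pmf bin_sub // subKn //; have -> : 1 - (1 - p) = p by ring.
ring.
Qed.

Lemma pmf_succ N p b : (b <= N)%N ->
  b.+1%:R * (1 - p) * pmf N p b.+1 = (N%:R - b%:R) * p * pmf N p b.
Proof.
move=> bN; rewrite /pmf.
have [->|/eqP bneN] := eqVneq b N.
  by rewrite bin_small // subrr !mul0r mulr0.
have bltN : (b < N)%N by lia.
have H : (b.+1%:R * 'C(N, b.+1)%:R = (N%:R - b%:R) * 'C(N, b)%:R :> R).
  by rewrite -natrM mul_bin_left natrM natrB.
have -> : (N - b = (N - b.+1).+1)%N by lia.
rewrite !exprS.
transitivity ((b.+1%:R * 'C(N, b.+1)%:R) * (1 - p) * p * p ^+ b * (1 - p) ^+ (N - b.+1)).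
  ring.
rewrite H; ring.
Qed.

(** The ratio of consecutive atoms is [1 - d / c] with [c = (b+1)(1-p)] and [d = (b+1) - (N+1)p].
    For [d <= 0] the atoms do not decrease; for [d > 0] one has [c >= Np(1-p)], so the ratio loses
    at most [l] over the variance. *)
Lemma pmf_step N p b (l : R) : 0 <= p <= 1 -> 0 < N%:R * p * (1 - p) -> 0 <= l ->
  b.+1%:R <= N.+1%:R * p + l ->
  (1 - l / (N%:R * p * (1 - p))) * pmf N p b <= pmf N p b.+1.
Proof.
move=> p01; set V := N%:R * p * (1 - p) => V0 l0 bl.
have [bN|Nb] := leqP b N; last first.
  by rewrite pmf_small // mulr0 pmf_ge0.
have /andP[p0 p1] := p01.
have p1' : p < 1.
  by rewrite lt_neqAle p1 andbT; apply/eqP => p_eq; move: V0; rewrite /V p_eq subrr mulr0 ltxx.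
have := pmf_succ p bN; have := pmf_ge0 N b p01; have := pmf_ge0 N b.+1 p01.
move: (pmf N p b) (pmf N p b.+1) => x y y0 x0 E.
set c := b.+1%:R * (1 - p) in E.
have c0 : 0 < c by rewrite mulr_gt0 ?ltr0n // subr_gt0.
set d : R := b.+1%:R - N.+1%:R * p.
have Ed : c * y = (c - d) * x.
  rewrite E /c /d -(natr1 b) -(natr1 N); ring.
have dl : d <= l by rewrite /d; lra.
have [d0|d0] := lerP d 0.
  have xy : x <= y.
    rewrite -(ler_pM2l c0) Ed; apply: ler_wpM2r => //; lra.
  apply: le_trans xy; rewrite ler_piMl // lerBlDr lerDl divr_ge0 // ltW //.
have cV : V <= c.
  rewrite /V /c ler_wpM2r //; first lra.
  have : (N%:R * p <= N.+1%:R * p) by rewrite ler_wpM2r // ler_nat.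
  rewrite /d in d0; lra.
have -> : y = (1 - d / c) * x.
  apply: (mulfI (lt0r_neq0 c0)); rewrite Ed; field; exact: lt0r_neq0.
rewrite ler_wpM2r // lerD2l lerN2 ler_pM //; first by rewrite ltW.
- by rewrite invr_ge0 ltW.
- by rewrite lef_pV2 ?posrE.
Qed.

(* Moving from [a] towards the mode and, if need be, past it, each of the next [L]
   atoms has at least half the mass of [a]. *)
Lemma pmf_le_left N p a L : 0 <= p <= 1 -> (0 < L)%N ->
  2 * L%:R ^+ 2 <= N%:R * p * (1 - p) -> a%:R <= N.+1%:R * p ->
  pmf N p a <= 2 / L%:R.
Proof.
move=> p01 L0 VL aN; set V := N%:R * p * (1 - p) in VL.
have L0R : 0 < L%:R :> R by rewrite ltr0n.
have L1R : 1 <= L%:R :> R by rewrite ler1n.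
have V0 : 0 < V by apply: lt_le_trans VL; rewrite mulr_gt0 ?exprn_gt0.
set x := pmf N p a.
have x0 : 0 <= x := pmf_ge0 N a p01.
(* Each step costs a factor of at least [1 - L / V], and [(1 - z) (1 - i z) >= 1 - (i + 1) z]. By
   [2 L^2 <= V] the total factor stays at least one half. *)
have step i : (i <= L)%N -> (1 - i%:R * (L%:R / V)) * x <= pmf N p (a + i).
  elim: i => [|i IH] iL; first by rewrite mul0r subr0 mul1r addn0.
  have lV : L%:R / V <= 1.
    by rewrite ler_pdivrMr // mul1r; apply: le_trans VL; nra.
  have lV0 : 0 <= L%:R / V by rewrite divr_ge0 // ltW.
  rewrite addnS; apply: le_trans (pmf_step p01 V0 (ltW L0R) _).
    rewrite -/V; move: (L%:R / V) lV lV0 (IH (ltnW iL)) => z z1 z0 H.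
    apply: (@le_trans _ _ ((1 - z) * ((1 - i%:R * z) * x))); last first.
      by rewrite ler_wpM2l // subr_ge0.
    rewrite mulrA ler_wpM2r // -natr1; have := ler0n R i; nra.
  have : (i.+1%:R <= L%:R :> R) by rewrite ler_nat.
  by rewrite -addnS natrD; lra.
have half i : (i < L)%N -> x / 2 <= pmf N p (a + i).
  move=> iL; apply: le_trans (step i (ltnW iL)); rewrite mulrC ler_wpM2r //.
  have : i%:R * (L%:R / V) <= 1 / 2.
    rewrite mulrA ler_pdivrMr //.
    have : i%:R * L%:R <= L%:R ^+ 2 :> R by rewrite expr2 ler_wpM2r // ler_nat ltnW.
    by lra.
  by lra.
(* The [L] atoms from [a] on have mass at least [x / 2] each, so [L x / 2 <= 1]. *)
have := sum_pmf_le1 N (a + L) p01; rewrite -(big_mkord xpredT (pmf N p)).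
rewrite (big_cat_nat (n := a)) ?leq_addr //= -{2}[a]add0n big_addn addKn => S1.
have S2 : \sum_(0 <= i < L) (x / 2) <= \sum_(0 <= i < L) pmf N p (i + a).
  rewrite !big_mkord; apply: ler_sum => i _; rewrite addnC; exact: half.
have S3 : 0 <= \sum_(0 <= i < a) pmf N p i by apply: sumr_ge0 => i _; exact: pmf_ge0.
move: S2; rewrite sumr_const_nat subn0 -mulr_natr => S2.
rewrite ler_pdivlMr //; lra.
Qed.

(** Right of the mode, the reflection [a -> N - a], [p -> 1 - p] leads back to the left side and
    preserves the variance. *)
Lemma pmf_le N p a L : 0 <= p <= 1 -> (0 < L)%N ->
  2 * L%:R ^+ 2 <= N%:R * p * (1 - p) -> pmf N p a <= 2 / L%:R.
Proof.
move=> p01 L0 VL; have /andP[p0 p1] := p01.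
have [aN|Na] := leqP a N; last first.
  by rewrite pmf_small // divr_ge0 ?ler0n.
have [ap|pa] := lerP a%:R (N.+1%:R * p); first exact: pmf_le_left.
rewrite pmf_sym //; apply: pmf_le_left => //.
- apply/andP; split; lra.
- have -> : 1 - (1 - p) = p by ring.
  by rewrite mulrAC.
- rewrite natrB // -natr1 in pa *; lra.
Qed.

End BinomialMass.

(** * Bernoulli random sets *)

Section BernoulliSubset.
Variables (R : realFieldType) (T : finType) (p : R).
Hypothesis p01 : 0 <= p <= 1.
Implicit Types (U B X Y Z : {set T}) (E : pred {set T}).

Definition bmass U X : R := \prod_(e in U) (if e \in X then p else 1 - p).

(** Each element of [U] is kept independently with probability [p]. The ground set is a parameter so
    that it can be cut into a block and its complement. *)
Definition bprob U E : R := \sum_(X : {set T} | (X \subset U) && E X) bmass U X.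

Lemma bmass_ge0 U X : 0 <= bmass U X.
Proof. by apply: prodr_ge0 => e _; case: ifP => _; move/andP: p01 => []; lra. Qed.

Lemma bprob_mono U E E' :
  (forall X, X \subset U -> E X -> E' X) -> bprob U E <= bprob U E'.
Proof.
move=> EE'; rewrite /bprob !big_mkcondr; apply: ler_sum => X XU.
case: ifP => [/(EE' _ XU)->//|_]; case: ifP => // _; exact: bmass_ge0.
Qed.

Lemma bmassE B Z : Z \subset B -> bmass B Z = p ^+ #|Z| * (1 - p) ^+ (#|B| - #|Z|).
Proof.
move=> ZB; rewrite /bmass (big_setID Z) /= (setIidPr ZB).
rewrite (eq_bigr (fun=> p)) => [|e ->//].
rewrite [X in _ * X](eq_bigr (fun=> 1 - p)); last first.
  by move=> e; rewrite inE => /andP[/negPf-> _].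
by rewrite !prodr_const cardsD (setIidPr ZB).
Qed.

Lemma sum_bmass_card B a :
  \sum_(Z : {set T} | (Z \subset B) && (#|Z| == a)) bmass B Z = pmf #|B| p a.
Proof.
rewrite (eq_bigr (fun=> p ^+ a * (1 - p) ^+ (#|B| - a))); last first.
  by move=> Z /andP[ZB /eqP<-]; exact: bmassE.
rewrite sumr_const.
have -> : #|[pred Z : {set T} | (Z \subset B) && (#|Z| == a)]| = 'C(#|B|, a).
  by rewrite -cards_draws cardsE.
by rewrite /pmf -mulrA mulr_natl.
Qed.

Lemma sum_bmass B : \sum_(Z : {set T} | Z \subset B) bmass B Z = 1.
Proof.
rewrite (partition_big (fun Z => inord #|Z| : 'I_#|B|.+1) xpredT) //=.
rewrite -(sum_pmf #|B| p); apply: eq_bigr => a _; rewrite -sum_bmass_card.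
apply: eq_bigl => Z; case ZB: (Z \subset B) => //=.
by rewrite -val_eqE /= inordK // ltnS subset_leq_card.
Qed.

Lemma bmass_split U B Y Z : B \subset U -> Y \subset U :\: B -> Z \subset B ->
  bmass U (Y :|: Z) = bmass (U :\: B) Y * bmass B Z.
Proof.
move=> BU YU ZB; rewrite /bmass (big_setID B) /= (setIidPr BU) mulrC.
congr (_ * _); apply: eq_bigr => e eB; rewrite inE.
  rewrite orbC; case: (boolP (e \in Z)) => //= /(subsetP ZB).
  by move: eB; rewrite inE => /andP[/negPf->].
by case: (boolP (e \in Y)) => //= /(subsetP YU); rewrite inE eB.
Qed.

Lemma sum_split U B (F : {set T} -> R) : B \subset U ->
  \sum_(X : {set T} | X \subset U) F X =
  \sum_(Y : {set T} | Y \subset U :\: B) \sum_(Z : {set T} | Z \subset B) F (Y :|: Z).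
Proof.
move=> BU; rewrite pair_big /=.
rewrite [RHS](reindex_onto (fun X => (X :\: B, X :&: B))
                           (fun YZ => YZ.1 :|: YZ.2)) /=; last first.
  move=> [Y Z] /= /andP[YU ZB]; congr (_, _); apply/setP => e; rewrite !inE.
    have := subsetP YU e; have := subsetP ZB e; rewrite !inE.
    by case: (e \in B); case: (e \in Y); case: (e \in Z) => //= H1 H2;
      rewrite ?(H1 isT) // ?(H2 isT).
  have := subsetP YU e; have := subsetP ZB e; rewrite !inE.
  by case: (e \in B); case: (e \in Y); case: (e \in Z) => //= H1 H2;
      rewrite ?(H1 isT) // ?(H2 isT).
apply: eq_big => [X|X _]; last by rewrite setUC setID.
rewrite setUC setID eqxx andbT subsetIr andbT.
apply/idP/idP => [XU|XB]; first exact: setSD.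
rewrite -(setID X B) subUset (subset_trans (subsetIr _ _) BU) /=.
by apply: subset_trans XB _; exact: subsetDl.
Qed.

(** The parts of the random set inside and outside [B] are independent, and the inner part has
    binomial size. Given the outer part, [E] forces one particular size, which has probability at
    most [q]. *)
Lemma bprob_block U B E E' (g : {set T} -> nat) (q : R) : B \subset U ->
  (forall a, pmf #|B| p a <= q) ->
  (forall X, E' X = E' (X :\: B)) ->
  (forall X, E X -> E' X /\ #|X :&: B| = g (X :\: B)) ->
  bprob U E <= q * bprob U E'.
Proof.
move=> BU pq E'B EB.
apply: le_trans (bprob_mono (E' := fun X => E' X && (#|X :&: B| == g (X :\: B))) _) _.
  by move=> X _ /EB[-> ->]; rewrite eqxx.
rewrite /bprob !big_mkcondr !(sum_split _ BU) mulr_sumr; apply: ler_sum => Y YU.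
have YZ Z : Z \subset B -> (Y :|: Z) :\: B = Y /\ (Y :|: Z) :&: B = Z.
  move=> ZB; split; apply/setP => e; have := subsetP YU e; have := subsetP ZB e;
  rewrite !inE;
  by case: (e \in B); case: (e \in Y); case: (e \in Z) => //= H1 H2;
      rewrite ?(H1 isT) // ?(H2 isT).
rewrite (eq_bigr (fun Z => if E' Y && (#|Z| == g Y)
    then bmass (U :\: B) Y * bmass B Z else 0)); last first.
  by move=> Z ZB; rewrite E'B; have [-> ->] := YZ Z ZB; rewrite (bmass_split BU YU).
rewrite [X in _ <= _ * X](eq_bigr (fun Z => if E' Y
    then bmass (U :\: B) Y * bmass B Z else 0)); last first.
  by move=> Z ZB; rewrite E'B; have [-> _] := YZ Z ZB; rewrite (bmass_split BU YU).
case: (E' Y) => /=; last by rewrite !big1 // mulr0.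
rewrite -big_mkcondr -!mulr_sumr sum_bmass mulr1 sum_bmass_card mulrC.
by rewrite ler_wpM2r ?bmass_ge0.
Qed.

(* Exposing the block of [j] last, its equation prescribes the number of block
   elements that are present, while the other equations ignore the block. *)
Lemma bprob_linear_system (I : eqType) (J : seq I) U (b : I -> {set T})
    (w : I -> T -> int) (t : int) (q : R) :
  uniq J -> t != 0 -> 0 <= q ->
  (forall j, j \in J -> b j \subset U) ->
  (forall j a, j \in J -> pmf #|b j| p a <= q) ->
  (forall i j e, i \in J -> j \in J -> e \in b j ->
     w i e = if i == j then t else 0) ->
  bprob U (fun X => all (fun i => \sum_(e in X) w i e == 0) J) <= q ^+ size J.
Proof.
move=> + t0 q0; elim: J => [_ _ _ _|j J IH /andP[jJ uJ] bU pq wb].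
  rewrite expr0 -(sum_bmass U) /bprob /= le_eqVlt; apply/orP; left.
  by apply/eqP; apply: eq_bigl => X; rewrite andbT.
rewrite exprS; apply: (@le_trans _ _
  (q * bprob U (fun X => all (fun i => \sum_(e in X) w i e == 0) J))); last first.
  rewrite ler_wpM2l // IH // => [i iJ|i a iJ|i i' e iJ i'J].
  - by apply: bU; rewrite inE iJ orbT.
  - by apply: pq; rewrite inE iJ orbT.
  - by apply: wb; rewrite inE ?iJ ?i'J orbT.
(* [g] solves the equation of [j] for the number of block elements present. When the equation holds,
   the division by [t] is exact and the quotient is nonnegative, so [absz] loses nothing. *)
apply: (bprob_block (B := b j)
  (g := fun Y => absz (divz (- \sum_(e in Y) w j e) t))).
- by apply: bU; exact: mem_head.
- by move=> a; apply: pq; exact: mem_head.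
- move=> X; apply: eq_in_all => i iJ; rewrite (big_setID (b j)) /= big1 ?add0r //.
  move=> e /setIP[_ eb]; rewrite (wb i j) ?mem_head ?inE ?iJ ?orbT //.
  by case: eqP => // ij; rewrite -ij iJ in jJ.
- move=> X /= /andP[/eqP wX ->]; split => //.
  have S : \sum_(e in X :&: b j) w j e = #|X :&: b j|%:Z * t.
    rewrite (eq_bigr (fun=> t)); first by rewrite sumr_const -mulr_natl natz.
    move=> e; rewrite inE => /andP[_ eb].
    by have := wb j j e (mem_head _ _) (mem_head _ _) eb; rewrite eqxx.
  have : \sum_(e in X :\: b j) w j e = - (#|X :&: b j|%:Z * t).
    by apply/eqP; rewrite -S -addr_eq0 addrC; move: wX; rewrite (big_setID (b j)) /= => ->.
  by move=> ->; rewrite opprK mulzK.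
Qed.

End BernoulliSubset.

(** * Equitable partitions *)

Lemma exists_subset_card (V : finType) (S : {set V}) m : (m <= #|S|)%N ->
  exists2 P : {set V}, P \subset S & #|P| = m.
Proof.
move=> mS; exists [set x in take m (enum S)].
  by apply/subsetP => x; rewrite inE => /mem_take; rewrite mem_enum.
rewrite cardsE (card_uniqP _) ?take_uniq ?enum_uniq // size_takel //.
by rewrite -cardE.
Qed.

(** * Choosing pivots, classes and block vertices *)

Section Selection.
Variables (V : finType) (rho : V -> V).
Hypothesis rhoK : forall v, rho (rho v) = rho v.
Local Open Scope nat_scope.

(** An idempotent [rho] encodes a partition: its fibres are the classes and its fixed points the
    chosen representatives. *)
Definition reps := [set v | rho v == v].

Definition untouched (P : {set V}) := ~: (P :|: rho @: P).

Lemma rho_reps v : rho v \in reps. Proof. by rewrite inE rhoK. Qed.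

(* If the non-representatives are few, removing a quarter of them kills few
   classes; otherwise one spare element per class can be set aside. *)
Lemma select_pivots : exists P : {set V},
  [/\ P \subset ~: reps, #|P| = (#|~: reps| + 3) %/ 4 &
      #|reps| <= #|rho @: untouched P| + (#|reps| + 1) %/ 2 /\
      (2 * #|reps| < #|~: reps| -> #|reps| <= #|rho @: untouched P|)].
Proof.
set m := #|~: reps|; set r := #|reps|.
have [mr|rm] := leqP m (2 * r).
  have [|P PN Pm] := @exists_subset_card V (~: reps) ((m + 3) %/ 4); first by rewrite -/m; lia.
  exists P; split=> //; split; last by move=> h; lia.
  (* A representative that is not the image of a pivot is itself untouched, so at most [#|P|]
     classes are lost. *)
  have RP : reps :\: rho @: P \subset rho @: untouched P.
    apply/subsetP => a /setDP[aR aP]; have /eqP ra : rho a == a by rewrite inE in aR.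
    rewrite -ra imset_f // !inE (negPf aP) orbF; apply/negP => /(subsetP PN).
    by rewrite inE aR.
  have := subset_leq_card RP; rewrite cardsD.
  have := leq_imset_card rho P; have := subset_leq_card (subsetIr reps (rho @: P)).
  rewrite -/r Pm; lia.
(* [s a] is a spare non-representative of class [a], if there is one. The pivots avoid all spares,
   so a class whose representative is touched keeps its spare. *)
pose s a := odflt a [pick v | (v \notin reps) && (rho v == a)].
have sP v : v \notin reps -> s (rho v) \notin reps /\ rho (s (rho v)) = rho v.
  move=> vN; rewrite /s; case: pickP => [w /andP[wN /eqP]|/(_ v)] //=.
  by rewrite vN eqxx.
have cS : m <= #|(~: reps) :\: s @: reps| + r.
  rewrite cardsD -/m; have := leq_imset_card s reps.
  have := subset_leq_card (subsetIr (~: reps) (s @: reps)); rewrite -/r; lia.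
have [|P PN Pm] := @exists_subset_card V ((~: reps) :\: s @: reps) ((m + 3) %/ 4).
  by lia.
exists P; have PN' : P \subset ~: reps by apply: subset_trans PN (subsetDl _ _).
suff RP : reps \subset rho @: untouched P.
  have := subset_leq_card RP; rewrite -/r => rQ; split=> //; split=> //; lia.
apply/subsetP => a aR; have /eqP ra : rho a == a by rewrite inE in aR.
have [aP|aP] := boolP (a \in rho @: P); last first.
  rewrite -ra imset_f // !inE (negPf aP) orbF; apply/negP => /(subsetP PN').
  by rewrite inE aR.
have /imsetP[v vP av] := aP.
have [|sN rs] := sP v; first by have := subsetP PN' v vP; rewrite inE.
rewrite av -rs imset_f // !inE negb_or; apply/andP; split.
  apply/negP => /(subsetP PN); rewrite !inE => /andP[/negP[]]; rewrite imset_f //.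
  exact: rho_reps.
by apply/negP => /imsetP[w _ sw]; move: sN; rewrite sw rho_reps.
Qed.

(** The classes met by untouched vertices are split into two halves; a half holding at least half of
    the untouched vertices supplies [B], the other one is [A]. A single class cannot be split: this
    is the last alternative, where [B] lies inside that class. *)
Lemma select_blocks : 100 <= #|V| -> ~: reps != set0 ->
  exists (P A B : {set V}) (u : V -> V),
  [/\ P \subset ~: reps, #|~: reps| <= 4 * #|P|, #|reps| < 16 * #|A|,
      #|V| <= 8 * #|B| & B \subset untouched P] /\
  (forall a, a \in A -> [/\ u a \in untouched P, u a \notin B & rho (u a) = a]) /\
  ((forall b, b \in B -> rho b \notin A) \/
   (exists a, A = [set a] /\ forall b, b \in B -> rho b = a)).
Proof.
move=> n100 N0; have [P [PN Pm [c1 c2]]] := select_pivots.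
set Q := untouched P in c1 c2 *; set r := #|reps| in c1 c2 *.
set m := #|~: reps| in Pm c2.
have rm : r + m = #|V| by rewrite /r /m cardsC.
have m0 : 0 < m by rewrite card_gt0.
have cQ : #|V| <= #|Q| + 2 * #|P|.
  have := (leq_card_setU P (rho @: P)).1; have := leq_imset_card rho P.
  by have := cardsC (P :|: rho @: P); rewrite /Q /untouched; lia.
have r0 : 0 < r.
  have /card_gt0P[v _] : 0 < #|~: reps| by [].
  by apply/card_gt0P; exists (rho v); exact: rho_reps.
(* The default value never matters, as [A] is always chosen inside [rho @: Q]. *)
pose u a := odflt a [pick v | (v \in Q) && (rho v == a)].
have uP a : a \in rho @: Q -> u a \in Q /\ rho (u a) = a.
  case/imsetP => v vQ ->; rewrite /u; case: pickP => [w /andP[wN /eqP]|/(_ v)] //=.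
  by rewrite vQ eqxx.
have PmV : 4 * #|P| <= m + 3 by lia.
have [r1|r2] := leqP r 1.
  have /cards1P[a Ra] : #|reps| == 1 by rewrite eqn_leq r1.
  have rhoa v : rho v = a by have := rho_reps v; rewrite Ra inE => /eqP.
  have aQ : a \in rho @: Q.
    have /card_gt0P[b /imsetP[v vQ _]] : 0 < #|rho @: Q| by lia.
    by apply/imsetP; exists v.
  have [uaQ _] := uP a aQ.
  exists P, [set a], (Q :\ u a), u; split; [split=> //|split].
  - by rewrite -/m; lia.
  - by rewrite cards1; move: r1; rewrite /r; lia.
  - have := cardsD1 (u a) Q; rewrite uaQ; lia.
  - exact: subsetDl.
  - by move=> b; rewrite inE => /eqP->; split; rewrite ?setD11.
  - by right; exists a; split.
have r'2 : 2 <= #|rho @: Q| /\ r %/ 2 <= #|rho @: Q|.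
  have [mr|/c2 rQ] := leqP m (2 * r); last by split; lia.
  by split; lia.
have [|A0 A0Q cA0] := @exists_subset_card V (rho @: Q) (#|rho @: Q| %/ 2); first lia.
pose QA := Q :&: rho @^-1: A0.
suff [A [B [AQ BQ cA cB AB]]] : exists A B : {set V}, [/\ A \subset rho @: Q, B \subset Q,
    #|rho @: Q| %/ 2 <= #|A|, #|Q| <= 2 * #|B| & forall b, b \in B -> rho b \notin A].
  exists P, A, B, u; split; [split=> //|split].
  - by rewrite -/m; lia.
  - by rewrite -/r; lia.
  - lia.
  - move=> a aA; have [uaQ rua] := uP a (subsetP AQ a aA); split=> //.
    by apply/negP => /AB; rewrite rua aA.
  - by left.
have cQA : #|QA| + #|Q :\: rho @^-1: A0| = #|Q| by rewrite cardsID.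
have [h|h] := leqP (2 * #|QA|) #|Q|.
  exists A0, (Q :\: rho @^-1: A0); split=> //; rewrite ?subsetDl ?cA0 //; first lia.
  by move=> b; rewrite !inE => /andP[].
exists (rho @: Q :\: A0), QA; split; rewrite ?subsetDl ?subsetIl //.
- by rewrite cardsD (setIidPr A0Q); lia.
- lia.
- by move=> b; rewrite !inE => /andP[_ ->].
Qed.

End Selection.

(** * Edge counts as counts of ordered tuples *)

Section TupleCounts.
Variables (k n : nat).
Local Notation V := 'I_n.
Implicit Types (X : {set {set V}}) (S : pred V) (v : V) (e : {set V}).

Definition ord_second : 'I_k.+2 := lift ord0 ord0.

(** For [(k+2)]-uniform [X] this is [k!] times the number of pairs of an edge through [v] and a
    further vertex of it in [S]. Ordered tuples match the entries of the adjacency tensor. *)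
Definition tuple_count X S v :=
  #|[set f : {ffun 'I_k.+2 -> V} |
     [&& f @: setT \in X, f ord0 == v & S (f ord_second)]]|.

Definition edge_weight S v e :=
  #|[set f : {ffun 'I_k.+2 -> V} |
     [&& f @: setT == e, f ord0 == v & S (f ord_second)]]|.

Lemma tuple_countE X S v : tuple_count X S v = (\sum_(e in X) edge_weight S v e)%N.
Proof.
rewrite /tuple_count -sum1_card.
rewrite (partition_big (fun f : {ffun 'I_k.+2 -> V} => f @: setT) (mem X)) /=; last first.
  by move=> f; rewrite inE => /andP[].
apply: eq_bigr => e eX; rewrite sum1_card; apply: eq_card => f.
rewrite !inE unfold_in /= inE; have [->|_] := eqVneq (f @: setT) e.
  by rewrite eX andbT.
by rewrite andbF.
Qed.

Lemma edge_weight_notin S v e : v \notin e -> edge_weight S v e = 0%N.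
Proof.
move=> ve; apply/eqP; rewrite cards_eq0; apply/eqP/setP => f; rewrite !inE.
apply/and3P => -[/eqP fe /eqP fv _]; move: ve.
by rewrite -fe -fv imset_f.
Qed.

(** The edge weight transported to positions along an enumeration of the edge: it depends only on
    which positions lie in [S]. *)
Definition pattern_weight (Pt : pred 'I_k.+2) :=
  #|[set s : {ffun 'I_k.+2 -> 'I_k.+2} |
     [&& s @: setT == setT, s ord0 == ord0 & Pt (s ord_second)]]|.

Lemma edge_weight_pattern S (g : 'I_k.+2 -> V) : injective g ->
  edge_weight S (g ord0) (g @: setT) = pattern_weight (S \o g).
Proof.
move=> gI; pose h (s : {ffun 'I_k.+2 -> 'I_k.+2}) := [ffun i => g (s i)].
have hI : injective h.
  by move=> s s' /ffunP E; apply/ffunP => i; have := E i; rewrite !ffunE => /gI.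
have him s : h s @: setT = g @: (s @: setT).
  by rewrite -imset_comp; apply: eq_imset => i; rewrite /= ffunE.
rewrite /pattern_weight -(card_imset _ hI) /edge_weight; apply: eq_card => f.
rewrite inE; apply/and3P/imsetP.
  case=> /eqP fg /eqP f0 Sf.
  have gf i : exists j, g j == f i.
    have : f i \in g @: setT by rewrite -fg imset_f.
    by case/imsetP => j _ ->; exists j.
  pose s := [ffun i => xchoose (gf i)].
  have fs : f = h s.
    by apply/ffunP => i; rewrite !ffunE; apply/esym/eqP; exact: (xchooseP (gf i)).
  move: s fs => s fs; exists s => //; rewrite inE; apply/and3P; split.
  - by apply/eqP; apply: (imset_inj gI); rewrite -him -fs fg.
  - by apply/eqP/gI; rewrite -f0 fs ffunE.
  - by move: Sf; rewrite fs ffunE.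
case=> s; rewrite inE => /and3P[/eqP s1 /eqP s0 Ps] ->; split.
- by rewrite him s1.
- by rewrite ffunE s0.
- by rewrite ffunE.
Qed.

(** A permutation that fixes position 0 sends the second position elsewhere, so the pattern is never
    evaluated at 0. *)
Lemma eq_pattern_weight (P1 P2 : pred 'I_k.+2) :
  (forall i, i != ord0 -> P1 i = P2 i) -> pattern_weight P1 = pattern_weight P2.
Proof.
move=> P12; apply: eq_card => s; rewrite !inE; case: eqP => //= sT; case: eqP => //= s0.
apply: P12; rewrite -s0; have /imset_injP sI : #|s @: setT| == #|[set: 'I_k.+2]| by rewrite sT.
by apply/negP => /eqP /sI; rewrite !inE => /(_ isT isT).
Qed.

Lemma pattern_weight_gt0 (Pt : pred 'I_k.+2) : Pt ord_second -> (0 < pattern_weight Pt)%N.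
Proof.
move=> P1; apply/card_gt0P; exists [ffun i => i]; rewrite inE !ffunE eqxx P1 !andbT /=.
apply/eqP/setP => i; rewrite inE; apply/imsetP; exists i => //; by rewrite ffunE.
Qed.

Lemma pattern_weight0 : pattern_weight pred0 = 0%N.
Proof.
by apply/eqP; rewrite cards_eq0; apply/eqP/setP => s; rewrite !inE !andbF.
Qed.

(** The edge is listed as [v], [u], then [e']. The weight is thus the same for all [e'] with the
    same pattern, which yields the constant coefficient of a block in the linear system. *)
Lemma edge_weight_block S v u (e' : {set V}) (Pt : pred 'I_k.+2) :
  v != u -> v \notin e' -> u \notin e' -> #|e'| = k ->
  Pt ord_second = S u ->
  (forall i x, i != ord0 -> i != ord_second -> x \in e' -> Pt i = S x) ->
  edge_weight S v (v |: (u |: e')) = pattern_weight Pt.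
Proof.
move=> vu ve ue e'k P1 P2; pose l := v :: u :: enum e'.
have ul : uniq l by rewrite /= enum_uniq inE !mem_enum negb_or vu ve ue.
have sl : size l = k.+2 by rewrite /= -cardE e'k.
pose g (i : 'I_k.+2) := nth v l i.
have gI : injective g.
  by move=> i j /eqP; rewrite nth_uniq ?sl // => /eqP /val_inj.
have gT : g @: setT = v |: (u |: e').
  apply/setP => x; rewrite !inE.
  have -> : [|| x == v, x == u | x \in e'] = (x \in l) by rewrite !inE mem_enum.
  apply/imsetP/idP => [[i _ ->]|xl]; first by rewrite mem_nth // sl.
  have xk : (index x l < k.+2)%N by rewrite -sl index_mem.
  by exists (Ordinal xk) => //; rewrite /g nth_index.
rewrite -gT -[v]/(g ord0) edge_weight_pattern //.
apply: eq_pattern_weight => i i0 /=; have [->|i1] := eqVneq i ord_second; first by rewrite P1.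
rewrite -(P2 i (g i)) // /g; case: i i0 i1 => [[|[|i]] //= ik] _ _.
by rewrite -mem_enum mem_nth // -cardE e'k.
Qed.

End TupleCounts.

(** * Probability that a fixed partition is equitable *)

Section Equitable.
Variables (R : realFieldType) (k n : nat).
Local Notation V := 'I_n.

Definition equitable (rho : V -> V) (X : {set {set V}}) :=
  [forall v, forall a, tuple_count k X (fun x => rho x == a) v ==
                       tuple_count k X (fun x => rho x == a) (rho v)].

Lemma bprob_equitable (p q : R) (rho : V -> V) :
  0 <= p <= 1 -> 0 <= q <= 1 -> (100 <= n)%N ->
  (forall v, rho (rho v) = rho v) -> ~: reps rho != set0 ->
  (forall b a, (n <= 8 * b)%N -> pmf 'C(b, k) p a <= q ^+ 64) ->
  bprob p [set e : {set V} | #|e| == k.+2] (equitable rho) <=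
  q ^+ (#|~: reps rho| * #|reps rho|.+1).
Proof.
move=> p01 /andP[q0 q1] n100 rhoK N0 pq; rewrite -[n]card_ord in n100 pq.
have [P [A [B [u [[PN Pm Ar nB BQ] [uP AB]]]]]] := select_blocks rhoK n100 N0.
pose block (j : V * V) := [set j.1 |: (u j.2 |: e') | e' in
  [set e' : {set V} | e' \subset B & #|e'| == k]].
pose w (j : V * V) (e : {set V}) : int :=
  (edge_weight k (fun x => rho x == j.2) j.1 e)%:Z -
  (edge_weight k (fun x => rho x == j.2) (rho j.1) e)%:Z.
(* The positions of a block edge that lie in class [a], that of [v] aside: only the second one if
   [B] avoids the classes of [A], all of them if [A] is a single class containing [B]. *)
pose Pt : pred 'I_k.+2 :=
  if [forall b in B, rho b \notin A] then pred1 (@ord_second k) else predT.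
pose J := [seq (v, a) | v <- enum P, a <- enum A].
have JE j : j \in J = (j.1 \in P) && (j.2 \in A).
  apply/allpairsP/andP => [[[v a] /= [vP aA ->]]|[vP aA]].
    by rewrite !mem_enum in vP aA.
  by exists j; rewrite !mem_enum; split=> //; case: j {vP aA}.
have outQ v x : v \in P -> x \in untouched rho P -> (x != v) && (x != rho v).
  move=> vP; rewrite !inE negb_or => /andP[xP xrP].
  by apply/andP; split; apply/eqP => xv; [move: xP|move: xrP]; rewrite xv ?vP // imset_f.
have vrv v : v \in P -> rho v != v by move=> /(subsetP PN); rewrite !inE.
have vB v : v \in P -> v \notin B /\ rho v \notin B.
  move=> vP; split; apply/negP => /(subsetP BQ) /(outQ v _ vP); rewrite eqxx ?andbF //.
have sizeJ : size J = (#|P| * #|A|)%N by rewrite size_allpairs -!cardE.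
apply: le_trans (_ : _ <= (q ^+ 64) ^+ size J) _; last first.
  (* With [m] non-representatives and [r] classes, [m <= 4 |P|] and [r + 1 <= 16 |A|] give
     [m (r + 1) <= 64 |P| |A|]; hence the exponent 64. *)
  rewrite -exprM sizeJ; apply: ler_wiXn2l => //; nia.
apply: le_trans
  (bprob_mono (E' := fun X => all (fun j => \sum_(e in X) w j e == 0) J) p01 _) _.
  move=> X _ /forallP eqX; apply/allP => -[v a] _.
  have /forallP/(_ a)/eqP := eqX v; rewrite !tuple_countE => E.
  rewrite /w sumrB subr_eq0 /=; apply/eqP.
  by rewrite -!(big_morph Posz PoszD (erefl 0)) E.
apply: (@bprob_linear_system _ _ p p01 _ J _ block w (pattern_weight Pt)%:Z) => //.
- by rewrite allpairs_uniq ?enum_uniq // => -[? ?] [? ?] _ _.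
- suff : (0 < pattern_weight Pt)%N by case: (pattern_weight Pt).
  by apply: pattern_weight_gt0; rewrite /Pt; case: ifP => //= _; rewrite eqxx.
- by rewrite exprn_ge0.
- move=> [v a]; rewrite JE /= => /andP[vP aA]; apply/subsetP => e /imsetP[e' /=].
  rewrite !inE => /andP[e'B /eqP e'k] ->.
  have [uaQ uaB _] := uP a aA; have [vB' _] := vB v vP.
  have ue' : u a \notin e' by apply: contra uaB; exact: (subsetP e'B).
  have ve' : v \notin e' by apply: contra vB'; exact: (subsetP e'B).
  have /andP[uv _] := outQ v _ vP uaQ.
  by rewrite !cardsU1 !inE negb_or (eq_sym v) uv ve' ue' e'k.
- move=> [v a] x; rewrite JE /= => /andP[vP aA]; have [uaQ uaB _] := uP a aA.
  have [vB' _] := vB v vP; have /andP[uv _] := outQ v _ vP uaQ.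
  rewrite card_in_imset ?cards_draws; first exact: pq.
  have out y (e : {set V}) : y \notin B -> e \subset B -> (y \in e) = false.
    by move=> yB /subsetP eB; apply: contraNF yB; exact: eB.
  move=> e1 e2; rewrite !inE /= => /andP[e1B _] /andP[e2B _] /setP E.
  apply/setP => y; have := E y; rewrite !inE.
  have [->|_] := eqVneq y v; first by rewrite (out v e1) // (out v e2).
  by have [->|_] //= := eqVneq y (u a); rewrite (out (u a) e1) // (out (u a) e2).
(* An edge in the block of [(v, a)] never contains [rho v1], since [v] is no representative. It
   contains [v1] only for [v1 = v], and then it meets class [a1] outside [v] only for [a1 = a]. *)
move=> [v1 a1] [v a] e; rewrite !JE /= => /andP[v1P a1A] /andP[vP aA] /imsetP[e' /=].
rewrite !inE => /andP[e'B /eqP e'k] ->.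
have [uaQ uaB rua] := uP a aA; have [vB' _] := vB v vP; have [v1B rv1B] := vB v1 v1P.
have ue' : u a \notin e' by apply: contra uaB; exact: (subsetP e'B).
have ve' : v \notin e' by apply: contra vB'; exact: (subsetP e'B).
have /andP[uv _] := outQ v _ vP uaQ.
have /andP[uv1 urv1] := outQ v1 _ v1P uaQ.
have v1e' : v1 \notin e' by apply: contra v1B; exact: (subsetP e'B).
have rv1e' : rho v1 \notin e' by apply: contra rv1B; exact: (subsetP e'B).
have rv1v : rho v1 != v.
  by apply/eqP => E; move: (vrv v vP); rewrite -E rhoK eqxx.
rewrite /w /= [X in _ - X%:Z]edge_weight_notin ?subr0; last first.
  by rewrite !inE !negb_or rv1v (eq_sym _ (u a)) urv1.
rewrite xpair_eqE; have [->|v1v] /= := eqVneq v1 v; last first.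
  by rewrite edge_weight_notin // !inE !negb_or v1v (eq_sym _ (u a)) uv1.
have vu : v != u a by rewrite eq_sym.
have [->|a1a] := eqVneq a1 a.
  congr _%:Z; apply: edge_weight_block => //.
    by rewrite rua eqxx /Pt; case: ifP => //= _; rewrite eqxx.
  move=> i x i0 i1 xe'; have xB : x \in B by exact: (subsetP e'B).
  rewrite /Pt; case: ifP => [/forall_inP/(_ x xB) xA /=|nB'].
    by rewrite (negPf i1); apply/esym; apply: contraNF xA => /eqP->.
  case: AB => [AB|[a2 [A2 ra2]]]; first by move/negP: nB' => []; apply/forall_inP.
  by rewrite ra2 //; move: aA; rewrite A2 inE => /eqP->; rewrite eqxx.
rewrite -[0]/(0%N%:Z) -(pattern_weight0 k); congr _%:Z; apply: edge_weight_block => //.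
  by rewrite rua eq_sym (negPf a1a).
move=> i x i0 i1 xe'; have xB : x \in B by exact: (subsetP e'B).
case: AB => [AB|[a2 [A2 ra2]]].
  by apply/esym; apply: contraNF (AB x xB) => /eqP->.
by move: aA a1A a1a; rewrite A2 !inE => /eqP-> /eqP->; rewrite eqxx.
Qed.

End Equitable.

(** * Counting partitions *)

Section UnionBound.
Local Open Scope nat_scope.

Lemma bin_le_exp n m : 'C(n, m) <= n ^ m.
Proof.
apply: leq_trans (leq_pmulr _ (fact_gt0 m)) _; rewrite bin_ffact.
elim: m => [|m IH]; first by rewrite ffactn0.
by rewrite ffactnSr expnS mulnC leq_mul // leq_subr.
Qed.

Lemma bin_le_exp2 n m : 'C(n, m) <= 2 ^ n.
Proof.
have [mn|nm] := leqP m n; last by rewrite bin_small.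
rewrite -[2]/(1 + 1) expnDn (bigD1 (Ordinal (mn : m < n.+1))) //=.
by rewrite !exp1n !muln1 leq_addr.
Qed.

(** For [2r <= n] the bound [2^n <= 4^(n-r)] suffices; otherwise [C(n, n-r) <= n^(n-r)] and
    [n < 2r]. *)
Lemma bin_le_max n r : 0 < r -> r < n -> 'C(n, r) <= (4 * r) ^ (n - r).
Proof.
move=> r0 rn; have [rh|rh] := leqP (2 * r) n.
  apply: leq_trans (bin_le_exp2 _ _) _.
  apply: (@leq_trans ((2 ^ 2) ^ (n - r))).
    by rewrite -expnM leq_pexp2l //; lia.
  by rewrite leq_exp2r; lia.
rewrite -bin_sub ?(ltnW rn) //; apply: leq_trans (bin_le_exp _ _) _.
by rewrite leq_exp2r; lia.
Qed.

(** With [m = n - r], the first two factors are at most [(4 r^2)^m <= 4^(m(r+1))] because [r < 2^r],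
    and [n <= m(r+1)] absorbs [2^n]. *)
Lemma classes_count n r : r < n ->
  'C(n, r) * r ^ (n - r) * 2 ^ n <= 8 ^ ((n - r) * r.+1).
Proof.
move=> rn; have [->|r0] := posnP r; first by rewrite exp0n; lia.
have mr : n <= (n - r) * r.+1 by nia.
apply: (@leq_trans (4 ^ ((n - r) * r.+1) * 2 ^ ((n - r) * r.+1))).
  apply: leq_mul; last by rewrite leq_pexp2l.
  apply: leq_trans (leq_mul (bin_le_max r0 rn) (leqnn _)) _.
  rewrite -expnMn [(n - r) * r.+1]mulnC expnM leq_exp2r; last by lia.
  rewrite expnS -mulnA leq_mul2l /= -[4]/(2 * 2) expnMn.
  by apply: leq_mul; apply: ltnW; exact: ltn_expl.
by rewrite -expnMn.
Qed.

(** Such a map is the identity on [A] and sends every other point into [A]. *)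
Lemma card_idempotent (V : finType) (A : {set V}) :
  #|[set rho : {ffun V -> V} | [forall v, rho (rho v) == rho v] &&
      (reps rho == A)]| <= #|A| ^ (#|V| - #|A|).
Proof.
pose F (x : V) : pred V := if x \in A then pred1 x else mem A.
apply: (@leq_trans #|family F|).
  apply/subset_leq_card/subsetP => rho; rewrite inE => /andP[/forallP rhoK /eqP rA].
  apply/familyP => v; rewrite /F -rA; case: ifP => [|_].
    by rewrite inE /= => /eqP ->; rewrite inE.
  by have := rhoK v; rewrite unfold_in /= inE.
rewrite card_family foldrE big_image /= (bigID (mem A)) /=.
rewrite big1 => [|x xA]; last by rewrite /F xA card1.
rewrite mul1n (eq_bigr (fun=> #|A|)) => [|x /negPf xA]; last by rewrite /F xA; apply: eq_card.
rewrite -(cardsC A) addKn -prod_nat_const; apply: eq_leq.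
by apply: eq_bigl => x; rewrite !inE.
Qed.

End UnionBound.

(** * Union bound over all partitions *)

Section ExistsEquitable.
Variables (R : realFieldType) (k n : nat).
Local Notation V := 'I_n.

Definition has_equitable (X : {set {set V}}) :=
  [exists rho : {ffun V -> V}, [&& [forall v, rho (rho v) == rho v],
     reps rho != setT & equitable k rho X]].

Lemma bprob_exists U (p : R) (I : finType) (Q : pred I) (E : I -> pred {set {set V}}) :
  0 <= p <= 1 ->
  bprob p U (fun X => [exists i, Q i && E i X]) <= \sum_(i | Q i) bprob p U (E i).
Proof.
move=> p01; rewrite /bprob.
rewrite (exchange_big_dep (fun X : {set {set V}} => X \subset U)) /=; last first.
  by move=> i X _ /andP[].
rewrite big_mkcondr; apply: ler_sum => X XU; case: ifP => [/existsP[i /andP[Qi EX]]|_].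
  rewrite (bigD1 i) /=; last by rewrite Qi XU EX.
  by rewrite lerDl sumr_ge0 // => j _; exact: bmass_ge0.
by apply: sumr_ge0 => j _; exact: bmass_ge0.
Qed.

Lemma bprob_has_equitable (p : R) : 0 <= p <= 1 -> (100 <= n)%N ->
  (forall b a, (n <= 8 * b)%N -> pmf 'C(b, k) p a <= (8^-1) ^+ 64) ->
  bprob p [set e : {set V} | #|e| == k.+2] has_equitable <= n%:R / 2 ^+ n.
Proof.
move=> p01 n100 pq.
have cV (A : {set V}) : (#|A| <= n)%N by rewrite -[X in (_ <= X)%N]card_ord max_card.
apply: le_trans (_ : _ <= \sum_(rho : {ffun V -> V} |
   [forall v, rho (rho v) == rho v] && (reps rho != setT))
   (8^-1) ^+ ((n - #|reps rho|) * #|reps rho|.+1)) _.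
  apply: le_trans (bprob_mono (E' := fun X => [exists rho : {ffun V -> V},
    ([forall v, rho (rho v) == rho v] && (reps rho != setT)) && equitable k rho X]) p01 _) _.
    by move=> X _ /existsP[rho H]; apply/existsP; exists rho; rewrite -andbA.
  apply: le_trans (bprob_exists _ _ _ p01) _.
  apply: ler_sum => rho /andP[/forallP rhoK rT].
  have -> : (n - #|reps rho| = #|~: reps rho|)%N.
    by rewrite -[X in (X - _)%N](card_ord n) -(cardsC (reps rho)) addKn.
  apply: bprob_equitable => //.
  - by apply/andP; split; lra.
  - by move=> v; apply/eqP.
  - by apply: contra rT => /eqP E; rewrite -[reps rho]setCK E setC0.
(* The partitions are grouped by their set [A] of representatives and then by [r = #|A|]. Each
   [r < n] contributes at most [2^-n] by [classes_count]. *)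
rewrite (partition_big (fun rho : {ffun V -> V} => reps rho)
  (fun A => A != setT)) /=; last first.
  by move=> rho /andP[].
apply: le_trans (_ : _ <= \sum_(A : {set V} | A != setT)
   (#|A| ^ (n - #|A|))%:R * (8^-1) ^+ ((n - #|A|) * #|A|.+1)) _.
  apply: ler_sum => A AT.
  rewrite (eq_bigr (fun=> (8^-1) ^+ ((n - #|A|) * #|A|.+1))); last first.
    by move=> rho /andP[_ /eqP->].
  rewrite sumr_const -[X in X <= _]mulr_natl ler_wpM2r ?exprn_ge0 ?invr_ge0 // ler_nat.
  rewrite -[X in (_ ^ (X - _))%N]card_ord; apply: leq_trans (card_idempotent A).
  by apply/subset_leq_card/subsetP => rho; rewrite !inE unfold_in /= => /andP[/andP[-> _] ->].
rewrite (partition_big (fun A : {set V} => inord #|A| : 'I_n.+1)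
  (fun r => (r < n)%N)) /=; last first.
  move=> A AT; rewrite inordK; last by rewrite ltnS.
  rewrite ltn_neqAle cV andbT.
  by apply: contra AT => /eqP cA; rewrite eqEcard subsetT cardsT /= card_ord cA.
apply: le_trans (_ : _ <= \sum_(r < n.+1 | (r < n)%N) (2^-1) ^+ n) _.
  apply: ler_sum => r rn.
  rewrite (eq_bigr (fun=> (r ^ (n - r))%:R * (8^-1) ^+ ((n - r) * r.+1))); last first.
    move=> A /andP[_ /eqP <-]; rewrite inordK //.
    by rewrite ltnS.
  rewrite sumr_const -[X in X <= _]mulr_natl.
  apply: (@le_trans _ _ ('C(n, r)%:R * ((r ^ (n - r))%:R * (8^-1) ^+ ((n - r) * r.+1)))).
    apply: ler_wpM2r; first by rewrite mulr_ge0 // exprn_ge0 // invr_ge0.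
    rewrite ler_nat -[X in 'C(X, _)](card_ord n) -card_draws.
    apply/subset_leq_card/subsetP => A; rewrite !inE unfold_in /= => /andP[_ /eqP<-].
    by rewrite inordK // ltnS.
  rewrite !exprVn mulrA -natrM ler_pdivrMr ?exprn_gt0 // mulrC ler_pdivlMr ?exprn_gt0 //.
  by rewrite -!natrX -natrM ler_nat classes_count.
rewrite sumr_const -[X in X <= _]mulr_natl exprVn.
apply: ler_wpM2r; first by rewrite invr_ge0 exprn_ge0.
by rewrite ler_nat -sum1_card -(big_ord_widen _ (fun=> 1%N)) // sum1_card card_ord.
Qed.

End ExistsEquitable.

(** * Colour refinement *)

Section Refinement.
Variables (k n : nat).
Local Notation V := 'I_n.
Local Open Scope nat_scope.
Implicit Types (X : {set {set V}}) (c : {ffun V -> nat}).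

Lemma eq_tuple_count X (S1 S2 : pred V) v :
  S1 =1 S2 -> tuple_count k X S1 v = tuple_count k X S2 v.
Proof. by move=> S12; apply: eq_card => f; rewrite !inE S12. Qed.

Lemma tuple_count_le X (S : pred V) v : tuple_count k X S v <= n ^ k.+2.
Proof.
apply: leq_trans (max_card _) _.
by rewrite card_ffun !card_ord.
Qed.

(** Old colour and new count are the two digits of a number in base [n^(k+2) + 1], which exceeds
    every count. Keys therefore compare lexicographically. *)
Definition refine_key X c i v :=
  c v * (n ^ k.+2).+1 + tuple_count k X (fun x => c x == i) v.

(** Ranks keep the colours below [n] and commute with isomorphisms. *)
Definition refine X c i : {ffun V -> nat} :=
  [ffun v => #|[set w | refine_key X c i w < refine_key X c i v]|].

Definition refine_iter X T :=
  iteri T (fun t c => refine X c (t %% n)) [ffun=> 0].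

(** Refining a colouring that equals its own rank function can only raise colours, so the sum of the
    colours measures progress. *)
Definition ranked c := forall v, c v = #|[set w | c w < c v]|.

Lemma refine_key_lt X c i v w :
  c w < c v -> refine_key X c i w < refine_key X c i v.
Proof.
move=> cwv; have := tuple_count_le X (fun x => c x == i) w.
rewrite /refine_key; move: (tuple_count _ _ _ _) (tuple_count _ _ _ _) => a b; nia.
Qed.

Lemma refine_lt X c i v w :
  (refine X c i w < refine X c i v) = (refine_key X c i w < refine_key X c i v).
Proof.
rewrite !ffunE; have [lt|le] := ltnP (refine_key X c i w) (refine_key X c i v).
  apply: proper_card; apply/properP; split.
    by apply/subsetP => x; rewrite !inE => /ltn_trans; apply.
  by exists w; rewrite !inE // ltnn.
apply/negbTE; rewrite -leqNgt; apply: subset_leq_card; apply/subsetP => x.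
by rewrite !inE => /leq_trans; apply.
Qed.

Lemma refine_ranked X c i : ranked (refine X c i).
Proof.
by move=> v; rewrite {1}ffunE; apply: eq_card => w; rewrite !inE refine_lt.
Qed.

Lemma refine_ge X c i : ranked c -> forall v, c v <= refine X c i v.
Proof.
move=> rc v; rewrite rc ffunE; apply: subset_leq_card; apply/subsetP => w.
by rewrite !inE; exact: refine_key_lt.
Qed.

Lemma refine_iter_ranked X T : ranked (refine_iter X T).
Proof.
case: T => [v|T]; last exact: refine_ranked.
by rewrite ffunE; apply/esym/eqP; rewrite cards_eq0; apply/eqP/setP => w; rewrite !inE.
Qed.

Lemma ranked_lt c v : ranked c -> c v < n.
Proof.
move=> ->; rewrite -[X in _ < X]card_ord -cardsT; apply: proper_card.
by apply/properP; split; [exact: subsetT|exists v; rewrite !inE // ltnn].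
Qed.

Definition stable X c := forall i, i < n -> refine X c i = c.

Lemma sum_refine X c i : ranked c -> refine X c i != c ->
  \sum_v c v < \sum_v refine X c i v.
Proof.
move=> rc; have le := refine_ge X i rc; apply: contraNltn => sle.
have : \sum_v c v == \sum_v refine X c i v by rewrite eqn_leq sle leq_sum.
have := leqif_sum (fun (v : V) (_ : true) => leqif_eq (le v)).
case=> _ ->; move=> /forallP /= E; apply/eqP/ffunP => v.
by have /eqP := E v.
Qed.

Lemma refine_iter_ge X s t : s <= t ->
  \sum_v refine_iter X s v <= \sum_v refine_iter X t v.
Proof.
elim: t => [|t IH]; first by rewrite leqn0 => /eqP->.
rewrite leq_eqVlt => /orP[/eqP-> //|/IH/leq_trans]; apply; apply: leq_sum => v _.
by apply: refine_ge; exact: refine_iter_ranked.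
Qed.

(* A pass over all colours that changes nothing certifies stability, any other
   pass increases the sum of the colours, which is less than [n ^ 2]. *)
Lemma refine_iter_stable X : 0 < n -> stable X (refine_iter X (n ^ 3)).
Proof.
move=> n0; have pass b : (exists2 s, s <= b * n & stable X (refine_iter X s)) \/
    b <= \sum_v refine_iter X (b * n) v.
  elim: b => [|b [[s sb st]|IH]]; first by right.
    by left; exists s => //; rewrite mulSn; lia.
  have [/forallP E|/forallPn[j ne]] := boolP [forall j : 'I_n,
      refine_iter X (b * n + j).+1 == refine_iter X (b * n + j)].
    left; exists (b * n); first by rewrite leq_mul.
    have E' j : j <= n -> refine_iter X (b * n + j) = refine_iter X (b * n).
      elim: j => [|j IHj] jn; first by rewrite addn0.
      by rewrite addnS (eqP (E (Ordinal jn))) IHj // ltnW.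
    move=> i ni; rewrite -[RHS](E' i.+1) // addnS /= modnMDl modn_small //.
    by rewrite (E' i) // ltnW.
  right; have lt : \sum_v refine_iter X (b * n + j) v <
                   \sum_v refine_iter X (b * n + j).+1 v.
    by apply: sum_refine => //; exact: refine_iter_ranked.
  apply: leq_ltn_trans IH _; apply: leq_ltn_trans (refine_iter_ge _ (leq_addr j _)) _.
  apply: leq_trans lt (refine_iter_ge _ _).
  by rewrite mulSn addnC -addSn leq_add2r.
have n3 : n ^ 2 * n = n ^ 3 by rewrite -expnSr.
have [[s sn st]|] := pass (n ^ 2); last first.
  rewrite leqNgt n3 => /negP[].
  apply: (@leq_ltn_trans (\sum_(v < n) n.-1)).
    apply: leq_sum => v _; rewrite -ltnS prednK //; apply: ranked_lt.
    exact: refine_iter_ranked.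
  by rewrite sum_nat_const card_ord; nia.
have st' t : s <= t -> refine_iter X t = refine_iter X s.
  elim: t => [|t IH]; first by rewrite leqn0 => /eqP->.
  rewrite leq_eqVlt => /orP[/eqP-> //|st']; rewrite /= -/(refine_iter X t) IH //.
  by apply: st; rewrite ltn_mod.
by rewrite st' // -n3.
Qed.

(** [rho] picks one vertex of each colour. By stability [v] and [rho v] have equal refined colours,
    hence equal keys and equal counts towards every class. *)
Lemma stable_has_equitable X c : ranked c -> stable X c ->
  ~~ injectiveb c -> has_equitable k X.
Proof.
move=> rc st nI; pose rho := [ffun v => odflt v [pick w | c w == c v]].
have crho v : c (rho v) = c v.
  by rewrite ffunE; case: pickP => [w /eqP|].
have rhoc v w : c v = c w -> rho v = rho w.
  move=> cvw; rewrite !ffunE cvw; case: pickP => //= /(_ w); by rewrite eqxx.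
have rhoE v w : (rho v == rho w) = (c v == c w).
  by apply/eqP/eqP => [E|/rhoc//]; rewrite -crho E crho.
apply/existsP; exists rho; apply/and3P; split.
- by apply/forallP => v; rewrite rhoE crho.
- apply: contra nI => /eqP rT; apply/injectiveP => v w /rhoc.
  have rv x : rho x = x by have := in_setT x; rewrite -rT inE => /eqP.
  by rewrite !rv.
apply/forallP => v; apply/forallP => a.
(* An [a] that is not a representative names an empty class. *)
have [ra|ra] := eqVneq (rho a) a; last first.
  rewrite !(@eq_tuple_count _ _ pred0); first last.
  - by move=> x /=; apply: contraNF ra => /eqP <-; rewrite rhoE crho.
  - by move=> x /=; apply: contraNF ra => /eqP <-; rewrite rhoE crho.
  by rewrite /tuple_count; apply/eqP/eq_card => f; rewrite !inE !andbF.
have S x : (rho x == a) = (c x == c a) by rewrite -{1}ra rhoE.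
rewrite !(eq_tuple_count _ _ S); have stc := st (c a) (ranked_lt a rc).
have : ~~ (refine X c (c a) v < refine X c (c a) (rho v)) by rewrite stc crho ltnn.
have : ~~ (refine X c (c a) (rho v) < refine X c (c a) v) by rewrite stc crho ltnn.
rewrite !refine_lt -!leqNgt => le1 le2.
have := eqn_leq (refine_key X c (c a) v) (refine_key X c (c a) (rho v)).
by rewrite le1 le2 /refine_key crho eqn_add2l.
Qed.

End Refinement.

Definition refinement_labeler k : labeler k.+2 := fun n H =>
  let c := refine_iter k (edges H) (n ^ 3) in
  if injectiveb c then Some c else None.

Lemma tuple_count_isomorphism k n (H H' : hypergraph k.+2 n) f (S S' : pred 'I_n) v :
  isomorphism H H' f -> (forall x, S x = S' (f x)) ->
  tuple_count k (edges H) S v = tuple_count k (edges H') S' (f v).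
Proof.
case=> [[g fK gK] Hf] SS'; pose h (t : {ffun 'I_k.+2 -> 'I_n}) := [ffun i => f (t i)].
have hI : injective h.
  move=> s t /ffunP E; apply/ffunP => i; have := E i; rewrite !ffunE.
  exact: (can_inj fK).
have him t : h t @: setT = f @: (t @: setT).
  by rewrite -imset_comp; apply: eq_imset => i; rewrite /= ffunE.
(* An isomorphism controls only sets of size [k+2]; sets of other sizes are non-edges on both sides
   by uniformity. *)
have Hh t : (h t @: setT \in edges H') = (t @: setT \in edges H).
  have [tk|tk] := eqVneq #|t @: setT| k.+2; first by rewrite him -Hf.
  rewrite [RHS](contraNF _ tk); last exact: (forall_inP (edges_uniform H)).
  apply: contraNF tk => /(forall_inP (edges_uniform H')).
  by rewrite him (card_imset _ (can_inj fK)).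
rewrite /tuple_count -(card_imset _ hI); apply: eq_card => t.
apply/imsetP/idP => [[s]|].
  rewrite inE => /and3P[sH /eqP sv Ss] ->.
  by rewrite inE Hh sH !ffunE sv eqxx -SS'.
rewrite inE => /and3P[tH /eqP tv St]; exists [ffun i => g (t i)].
  rewrite inE -Hh !ffunE tv fK eqxx SS' gK St andbT /=.
  suff -> : h [ffun i => g (t i)] = t by rewrite tH.
  by apply/ffunP => i; rewrite !ffunE gK.
by apply/ffunP => i; rewrite !ffunE gK.
Qed.

Lemma refine_isomorphism k n (H H' : hypergraph k.+2 n) f
    (c c' : {ffun 'I_n -> nat}) i :
  isomorphism H H' f -> (forall v, c v = c' (f v)) ->
  forall v, refine k (edges H) c i v = refine k (edges H') c' i (f v).
Proof.
move=> Hf cc' v; have [fB _] := Hf; rewrite !ffunE.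
have keyE w : refine_key k (edges H) c i w = refine_key k (edges H') c' i (f w).
  rewrite /refine_key cc' (tuple_count_isomorphism (S' := fun x => c' x == i) _ Hf) //.
  by move=> x; rewrite cc'.
rewrite -(card_imset _ (bij_inj fB)); apply: eq_card => w.
apply/imsetP/idP => [[x]|]; first by rewrite !inE !keyE => lt ->.
case: fB => g fK gK; rewrite inE => lt; exists (g w); last by rewrite gK.
by rewrite inE !keyE gK.
Qed.

Lemma refinement_labeler_canonical k : canonical_labeler (@refinement_labeler k).
Proof.
move=> n H L; rewrite /refinement_labeler.
case: injectiveP => // cI [<-]; split=> // H' f Hf.
have cc' T v : refine_iter k (edges H) T v = refine_iter k (edges H') T (f v).
  elim: T v => [|T IH] v; first by rewrite !ffunE.
  exact: refine_isomorphism.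
case: injectiveP => [_|[]]; first by exists (refine_iter k (edges H') (n ^ 3)).
move=> x y; have [[g fK gK] _] := Hf.
by rewrite -[x]gK -[y]gK -!cc' => /cI ->.
Qed.

Lemma refinement_labeler_fails k n (H : hypergraph k.+2 n) : (0 < n)%N ->
  refinement_labeler H = None -> has_equitable k (edges H).
Proof.
move=> n0; rewrite /refinement_labeler; case: ifPn => // nI _.
by apply: stable_has_equitable (refine_iter_stable _ _ n0) nI; exact: refine_iter_ranked.
Qed.

(** * Implementation on the word RAM *)

Section Digits.
Local Open Scope nat_scope.
Variables (n : nat) (n0 : 0 < n).

Definition mod_ord j : 'I_n := Ordinal (ltn_pmod j n0).

Lemma digits_inj K j j' : j < n ^ K -> j' < n ^ K ->
  (forall i, i < K -> j %/ n ^ i %% n = j' %/ n ^ i %% n) -> j = j'.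
Proof.
elim: K j j' => [|K IH] j j'; first by rewrite expn0 !ltnS !leqn0 => /eqP-> /eqP->.
rewrite expnS mulnC => jK j'K E; rewrite (divn_eq j n) (divn_eq j' n).
have := E 0 isT; rewrite expn0 !divn1 => ->; congr (_ * _ + _).
apply: IH; rewrite ?ltn_divLR // => i iK.
by have := E i.+1 iK; rewrite expnS !divnMA.
Qed.

Definition digit_tuple K j : {ffun 'I_K -> 'I_n} := [ffun i : 'I_K => mod_ord (j %/ n ^ i)].

Lemma digit_tuple_bij K : bijective (fun j : 'I_(n ^ K) => digit_tuple K j).
Proof.
apply: inj_card_bij; last by rewrite card_ffun !card_ord.
move=> j j' /ffunP E; apply/val_inj/(digits_inj (ltn_ord j) (ltn_ord j')) => i iK.
by have := E (Ordinal iK); rewrite !ffunE => /(congr1 val).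
Qed.

Lemma digit_tuple_set K j : digit_tuple K j @: setT = digit_set K n j.
Proof.
apply/setP => v; rewrite inE; apply/imsetP/existsP => [[i _ ->]|[i /eqP E]]; exists i => //.
  by rewrite ffunE.
by apply/val_inj; rewrite ffunE /= E.
Qed.

(** Base-[n] digits identify addresses with tuples, so the count becomes a sum along one scan of the
    tensor. *)
Lemma tuple_count_sum k X (S : pred 'I_n) v : tuple_count k X S v =
  \sum_(0 <= j < n ^ k.+2)
    [&& digit_set k.+2 n j \in X, j %% n == v & S (mod_ord (j %/ n))].
Proof.
rewrite /tuple_count -sum1dep_card big_mkcond /=.
rewrite (reindex _ (onW_bij _ (digit_tuple_bij k.+2))) /= big_mkord.
apply: eq_bigr => j _; rewrite digit_tuple_set !ffunE -val_eqE /= expn0 divn1.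
by rewrite expn1; case: ifP.
Qed.

End Digits.

(** * Hoare triples for total correctness with a time bound *)

Section Triples.
Local Open Scope nat_scope.
Variable W : nat.
Implicit Types (P Q : store -> Prop) (c : cmd).

Definition triple P c T Q :=
  forall s, P s -> exists t s', [/\ exec W c s t s', Q s' & t <= T].

Lemma triple_seq P Q Q' c1 c2 T1 T2 :
  triple P c1 T1 Q -> triple Q c2 T2 Q' -> triple P (Seq c1 c2) (T1 + T2) Q'.
Proof.
move=> H1 H2 s /H1[t1 [s1 [e1 /H2[t2 [s2 [e2 Qs2 le2]]] le1]]].
by exists (t1 + t2), s2; split=> //; [exact: exec_Seq e1 e2|exact: leq_add].
Qed.

Lemma triple_conseq P P' Q Q' c T : (forall s, P' s -> P s) -> (forall s, Q s -> Q' s) ->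
  triple P c T Q -> triple P' c T Q'.
Proof. by move=> PP QQ H s /PP/H[t [s' [e /QQ q le]]]; exists t, s'. Qed.

Lemma triple_assign P Q a i e T : ecost i + ecost e < T ->
  (forall s, P s -> [/\ fits W s i, fits W s e & Q (update s a (eval s i) (eval s e))]) ->
  triple P (Assign a i e) T Q.
Proof.
move=> le H s /H[fi fe q].
exists (ecost i + ecost e).+1, (update s a (eval s i) (eval s e)).
by split=> //; exact: exec_Assign.
Qed.

Definition var a := Get a (Cst 0).

Definition for_loop x b body :=
  Seq (Assign x (Cst 0) (Cst 0))
      (While (Bin Lt (var x) b) (Seq body (Assign x (Cst 0) (Bin Add (var x) (Cst 1))))).

(** [I i] holds before iteration [i] and may not depend on the counter. The bound [b] is evaluated
    anew at every test, so its value must stay [N]. A round adds [ecost b + 4] for the test and 6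
    for the increment. *)
Lemma triple_for x b body N T (I : nat -> store -> Prop) : 0 < W -> N <= W ->
  (forall i s, I i s -> fits W s b /\ eval s b = N) ->
  (forall i s v, I i s -> I i (update s x 0 v)) ->
  (forall i, i < N -> triple (fun s => I i s /\ s x 0 = i) body T
                             (fun s => I i.+1 s /\ s x 0 = i)) ->
  triple (I 0) (for_loop x b body) (N.+1 * (T + ecost b + 10)) (I N).
Proof.
move=> W0 NW Ib Ix body_ok.
have loop d : triple (fun s => I (N - d) s /\ s x 0 = N - d)
    (While (Bin Lt (var x) b) (Seq body (Assign x (Cst 0) (Bin Add (var x) (Cst 1)))))
    (d * (T + ecost b + 10) + ecost b + 4) (I N).
  have fit d' s : I (N - d') s -> s x 0 = N - d' ->
      fits W s (Bin Lt (var x) b) /\ eval s (Bin Lt (var x) b) = (N - d' < N).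
    move=> Is sx; have [fb eb] := Ib _ _ Is; split; last by rewrite /= sx eb.
    rewrite /= fb sx andbT /=; apply/and3P; split=> //; last by lia.
    by apply: leq_trans W0; case: (_ < _).
  elim: d => [|d IH] s [Is sx].
    have [f e] := fit 0 _ Is sx; rewrite subn0 ltnn in e.
    exists (ecost (Bin Lt (var x) b)).+1, s; split; first exact: exec_WhileF.
      by rewrite subn0 in Is.
    by rewrite /=; lia.
  (* For [N <= d] both truncated differences are 0, and the case [d] applies with time to spare. *)
  have [Nd|dN] := leqP N d.
    have E : N - d.+1 = N - d by lia.
    have [] := IH s; first by rewrite -E.
    by move=> t [s' [e q le]]; exists t, s'; split=> //; lia.
  have [f e] := fit d.+1 _ Is sx.
  have lt : N - d.+1 < N by lia.
  have [t1 [s1 [e1 [I1 x1] le1]]] := body_ok _ lt s (conj Is sx).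
  have E : (N - d.+1).+1 = N - d by lia.
  pose s2 := update s1 x 0 (N - d).
  have e2 : exec W (Assign x (Cst 0) (Bin Add (var x) (Cst 1))) s1 6 s2.
    have -> : s2 = update s1 x (eval s1 (Cst 0)) (eval s1 (Bin Add (var x) (Cst 1))).
      by rewrite /s2 /= x1 addn1 E.
    by apply: (@exec_Assign W x (Cst 0) (Bin Add (var x) (Cst 1)) s1);
      rewrite //= x1 W0 /=; lia.
  have [|t3 [s3 [e3 q3 le3]]] := IH s2.
    by split; [apply: Ix; rewrite -E|rewrite /s2 /update !eqxx].
  exists (ecost (Bin Lt (var x) b) + (t1 + 6) + t3).+1, s3; split=> //.
    apply: exec_WhileT e3 => //; first by rewrite e lt.
    exact: exec_Seq e1 e2.
  by rewrite /=; lia.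
move=> s I0; pose s1 := update s x 0 0.
have e1 : exec W (Assign x (Cst 0) (Cst 0)) s 3 s1 by exact: exec_Assign.
have [|t2 [s2 [e2 q2 le2]]] := loop N s1.
  by rewrite subnn; split; [exact: Ix|rewrite /s1 /update !eqxx].
exists (3 + t2), s2; split=> //; first exact: exec_Seq e1 e2.
by rewrite mulSn; lia.
Qed.

End Triples.

(** * The program and its correctness *)

Section Program.
Local Open Scope nat_scope.
Variable k : nat.

Fixpoint power_expr m :=
  if m is m'.+1 then Bin Mul (var 0) (power_expr m') else Cst 1.

(* Array 3 holds the colours, 4 the counts and 5 the keys; arrays 6 to 9 hold loop
   counters and array 10 an accumulator. *)
Definition clear_cmd := for_loop 8 (var 0) (Assign 4 (var 8) (Cst 0)).

(** The tensor address is decoded on the fly into the vertex and the vertex whose colour is tested;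
    multiplying bits serves as conjunction. *)
Definition count_cmd := for_loop 7 (power_expr k.+2)
  (Assign 4 (Bin Mod (var 7) (var 0))
    (Bin Add (Get 4 (Bin Mod (var 7) (var 0)))
      (Bin Mul (Get 1 (var 7))
        (Bin Eq (Get 3 (Bin Mod (Bin Div (var 7) (var 0)) (var 0)))
                (Bin Mod (var 6) (var 0)))))).

Definition key_cmd := for_loop 8 (var 0)
  (Assign 5 (var 8) (Bin Add
    (Bin Mul (Get 3 (var 8)) (Bin Add (power_expr k.+2) (Cst 1)))
    (Get 4 (var 8)))).

Definition rank_cmd := for_loop 8 (var 0)
  (Seq (Assign 3 (var 8) (Cst 0))
    (for_loop 9 (var 0)
      (Assign 3 (var 8) (Bin Add (Get 3 (var 8))
        (Bin Lt (Get 5 (var 9)) (Get 5 (var 8))))))).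

Definition refine_cmd := Seq clear_cmd (Seq count_cmd (Seq key_cmd rank_cmd)).

Definition check_cmd := Seq
  (for_loop 8 (var 0) (for_loop 9 (var 0)
    (Assign 10 (Cst 0) (Bin Add (var 10)
      (Bin Eq (Get 3 (var 8)) (Get 3 (var 9)))))))
  (Assign 2 (Cst 0) (Bin Eq (var 10) (var 0))).

Definition refinement_cmd := Seq (for_loop 6 (power_expr 3) refine_cmd) check_cmd.

Variables (n : nat) (n0 : 0 < n) (H : hypergraph k.+2 n) (W : nat).
Local Notation M := (n ^ k.+2).
Hypothesis HW : n.+1 * M.+1 + n ^ 3 + 3 <= W.
Local Notation p := (ecost (power_expr k.+2)).

Lemma triple_le P c T T' Q : T <= T' -> triple W P c T Q -> triple W P c T' Q.
Proof.
move=> TT' h s /h[t [s' [e q le]]]; exists t, s'; split=> //; exact: leq_trans le TT'.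
Qed.

Lemma eval_power m s : eval s (power_expr m) = s 0 0 ^ m.
Proof. by elim: m => //= m ->; rewrite expnS. Qed.

Lemma fits_power m s : s 0 0 = n -> n ^ m <= W -> fits W s (power_expr m).
Proof.
move=> s0; elim: m => [|m IH] /=; first by rewrite expn0 andbT.
move=> nW; have nW' : n ^ m <= W by apply: leq_trans nW; rewrite expnS leq_pmull.
rewrite eval_power s0 -expnS nW IH //= andbT; lia.
Qed.

(** The three scales of stored values: tensor addresses and counts, round numbers, and keys. *)
Lemma word_bounds : [/\ M + n + 4 <= W, n ^ 3 + 3 <= W & n * M + M + n + 4 <= W].
Proof. by move: HW; move: M (n ^ 3) => m x h; split; nia. Qed.

Lemma n_le_M : n <= M. Proof. by rewrite expnS leq_pmulr // expn_gt0 n0. Qed.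

(** The state at the start of round [t]. Array 10 must stay 0 for the final check, which accumulates
    there. *)
Definition base t (c : {ffun 'I_n -> nat}) (s : store) :=
  [/\ s 0 0 = n, forall j, s 1 j = (j < M) && (digit_set k.+2 n j \in edges H),
      s 6 0 = t, s 10 0 = 0 & forall v : 'I_n, s 3 v = c v].

Definition hit (c : {ffun 'I_n -> nat}) i (v : 'I_n) j : bool :=
  [&& digit_set k.+2 n j \in edges H, j %% n == v & c (mod_ord n0 (j %/ n)) == i].

Lemma triple_clear t c : triple W (base t c) clear_cmd (n.+1 * 20)
  (fun s => base t c s /\ forall v : 'I_n, s 4 v = 0).
Proof.
have nM := n_le_M; have [W1 W2 W3] := word_bounds.
apply: (@triple_conseq W (fun s => base t c s /\ forall v : 'I_n, v < 0 -> s 4 v = 0) _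
   (fun s => base t c s /\ forall v : 'I_n, v < n -> s 4 v = 0)) => [s b|s [b h]|].
- by split.
- by split=> // v; exact: h.
apply: triple_le (triple_for (T := 4) (N := n)
   (I := fun i s => base t c s /\ forall v : 'I_n, v < i -> s 4 v = 0) _ _ _ _ _).
- by rewrite /=; lia.
- by lia.
- by lia.
- by move=> i s [[s0 _ _ _ _] _]; rewrite /= s0; split=> //; apply/andP; split; lia.
- by move=> i s v.
move=> i ni; apply: triple_assign => // s [[[s0 s1 s6 s10 s3] s4] s8].
rewrite /= s8; split; [by apply/andP; split; lia|by []|].
split=> //; split=> // v vi; rewrite /update /=; case: eqP => // /eqP ne.
by apply: s4; lia.
Qed.

Lemma triple_count t (c : {ffun 'I_n -> nat}) : t < n ^ 3 -> (forall v, c v < n) -> triple W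
  (fun s => base t c s /\ forall v : 'I_n, s 4 v = 0) count_cmd (M.+1 * (p + 60))
  (fun s => base t c s /\
     forall v : 'I_n, s 4 v = tuple_count k (edges H) (fun x => c x == t %% n) v).
Proof.
move=> tn cn; have nM := n_le_M; have [W1 W2 W3] := word_bounds.
pose I i s := base t c s /\
  forall v : 'I_n, s 4 v = \sum_(0 <= j < i) hit c (t %% n) v j.
apply: (@triple_conseq W (I 0) _ (I M)) => [s [b h]|s [b h]|].
- by split=> // v; rewrite big_geq.
- by split=> // v; rewrite h (tuple_count_sum n0).
apply: triple_le (triple_for (T := 50) (N := M) (I := I) _ _ _ _ _).
- by rewrite leq_mul2l; apply/orP; right; lia.
- by lia.
- by lia.
- move=> i s [[s0 _ _ _ _] _]; rewrite eval_power s0; split=> //.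
  by apply: fits_power => //; lia.
- by move=> i s v.
move=> i iM; apply: triple_assign => // s [[[s0 s1 s6 s10 s3] s4] s7].
pose v := mod_ord n0 i; pose u := mod_ord n0 (i %/ n).
have q1 : i %% n < n by rewrite ltn_mod.
have q2 : t %% n < n by rewrite ltn_mod.
have q3 : i %/ n %% n < n by rewrite ltn_mod.
have q4 : i %/ n <= i by rewrite leq_div.
have s4v : s 4 (i %% n) = \sum_(0 <= j < i) hit c (t %% n) v j by rewrite -(s4 v).
have s3u : s 3 (i %/ n %% n) = c u by rewrite -(s3 u).
have cu := cn u; have s4i : s 4 (i %% n) <= i.
  rewrite s4v; apply: (@leq_trans (\sum_(0 <= j < i) 1)).
    by apply: leq_sum => j _; case: hit.
  by rewrite sum_nat_const_nat muln1 subn0.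
have q5 : i %% n = v by []. have q6 : i %/ n %% n = u by [].
have vn := ltn_ord v; have un := ltn_ord u.
rewrite /= s7 s0 s6 s1 iM /= s3u; split.
- by rewrite q5; repeat (apply/andP; split); lia.
- move: q1 q2 q3 q4 s4i; move: (i %% n) (t %% n) (i %/ n %% n) (i %/ n) => a1 a2 a3 a4.
  by case: (_ \in _); case: (_ == _) => /= *; repeat (apply/andP; split); lia.
split=> //; split=> // x; rewrite /update /= big_nat_recr //= -s4.
case: eqP => [E|ne].
  by rewrite /hit -E eqxx /= mulnb.
rewrite s4 /hit; suff -> : (i %% n == x) = false by rewrite andbF addn0.
by apply/eqP => E; apply: ne.
Qed.

Lemma triple_key t (c : {ffun 'I_n -> nat}) : (forall v, c v < n) -> triple W
  (fun s => base t c s /\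
     forall v : 'I_n, s 4 v = tuple_count k (edges H) (fun x => c x == t %% n) v)
  key_cmd (n.+1 * (p + 60))
  (fun s => base t c s /\
     forall v : 'I_n, s 5 v = refine_key k (edges H) c (t %% n) v).
Proof.
move=> cn; have nM := n_le_M; have [W1 W2 W3] := word_bounds.
pose I i s := (base t c s /\
    forall v : 'I_n, s 4 v = tuple_count k (edges H) (fun x => c x == t %% n) v) /\
  forall v : 'I_n, v < i -> s 5 v = refine_key k (edges H) c (t %% n) v.
apply: (@triple_conseq W (I 0) _ (I n)) => [s h|s [[b _] h]|].
- by split.
- by split=> // v; exact: h.
apply: triple_le (triple_for (T := p + 40) (N := n) (I := I) _ _ _ _ _).
- by rewrite leq_mul2l; apply/orP; right; rewrite /=; lia.
- by lia.
- by lia.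
- by move=> i s [[[s0 _ _ _ _] _] _]; rewrite /= s0; split=> //; apply/andP; split; lia.
- by move=> i s v.
move=> i ni; apply: triple_assign => [|s [[[[s0 s1 s6 s10 s3] s4] s5] s8]].
  by rewrite /=; lia.
pose v := Ordinal ni; have s3v : s 3 i = c v := s3 v.
have s4v : s 4 i = tuple_count k (edges H) (fun x => c x == t %% n) v := s4 v.
have fM : fits W s (power_expr k.+2) by apply: fits_power => //; lia.
have fk : c v * M.+1 <= n * M.+1 by rewrite leq_mul2r; apply/orP; right; exact: ltnW.
rewrite [n * _]mulnS in fk.
have fd := tuple_count_le k (edges H) (fun x => c x == t %% n) v.
have vc := cn v; have evM : eval s (power_expr k.+2) = M by rewrite eval_power s0.
move: (power_expr k.+2) fM evM => pe fM evM.
rewrite /= s8 s3v s4v fM evM addn1; split.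
- by apply/andP; split; lia.
- move: fk fd; move: (tuple_count _ _ _ _) (c v * M.+1) => a b fk fd.
  by repeat (apply/andP; split); lia.
split=> //; split=> // x xi; rewrite /update /=; case: eqP => [E|ne].
  by have -> : x = v by exact: val_inj.
by apply: s5; lia.
Qed.

Lemma mod_ord_id (v : 'I_n) : mod_ord n0 v = v.
Proof. by apply/val_inj; rewrite /= modn_small. Qed.

Lemma triple_rank t (c : {ffun 'I_n -> nat}) : (forall v, c v < n) -> triple W
  (fun s => base t c s /\
     forall v : 'I_n, s 5 v = refine_key k (edges H) c (t %% n) v)
  rank_cmd (n.+1 * (n.+1 * 60 + 60))
  (base t (refine k (edges H) c (t %% n))).
Proof.
move=> cn; have nM := n_le_M; have [W1 W2 W3] := word_bounds.
pose key := refine_key k (edges H) c (t %% n).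
(* The colours are overwritten in place. This is sound since ranking reads only the keys in array 5,
   so [frame] leaves array 3 out. *)
pose frame s := [/\ s 0 0 = n,
  forall j, s 1 j = (j < M) && (digit_set k.+2 n j \in edges H),
  s 6 0 = t, s 10 0 = 0 & forall v : 'I_n, s 5 v = key v].
pose I i s := frame s /\
  forall v : 'I_n, v < i -> s 3 v = refine k (edges H) c (t %% n) v.
apply: (@triple_conseq W (I 0) _ (I n)) => [s [[s0 s1 s6 s10 _] s5]|s [[s0 s1 s6 s10 s5] s3]|].
- by split.
- by split=> // v; exact: s3.
apply: triple_le (triple_for (T := 4 + n.+1 * 40) (N := n) (I := I) _ _ _ _ _).
- by rewrite leq_mul2l; apply/orP; right; rewrite /=; lia.
- by lia.
- by lia.
- by move=> i s [[s0 _ _ _ _] _]; rewrite /= s0; split=> //; apply/andP; split; lia.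
- by move=> i s v.
move=> i ni; pose v := Ordinal ni.
pose J j s := [/\ I i s, s 8 0 = i &
  s 3 i = \sum_(0 <= w < j) (key (mod_ord n0 w) < key v)].
apply: (triple_seq (Q := J 0)).
  apply: triple_assign => // s [[[s0 s1 s6 s10 s5] s3] s8].
  rewrite /= s8; split=> //; first by apply/andP; split; lia.
  split=> //; last by rewrite /update !eqxx big_geq.
  split=> // x xi; rewrite /update /=; case: eqP => [E|_]; [lia|exact: s3].
apply: (@triple_conseq W (J 0) _ (J n)) => [s //|s [[f s3] s8 s3i]|].
  split=> //; split=> // x; rewrite ltnS leq_eqVlt => /orP[/eqP xi|]; last exact: s3.
  have -> : x = v by exact: val_inj.
  rewrite s3i ffunE -sum1dep_card big_mkord [RHS]big_mkcond; apply: eq_bigr => w _.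
  by rewrite mod_ord_id /key; case: (_ < _).
apply: triple_le (triple_for (T := 25) (N := n) (I := J) _ _ _ _ _).
- by rewrite leq_mul2l; apply/orP; right.
- by lia.
- by lia.
- by move=> j s [[[s0 _ _ _ _] _] _ _]; rewrite /= s0; split=> //; apply/andP; split; lia.
- by move=> j s x.
move=> j nj; apply: triple_assign => // s [[[[s0 s1 s6 s10 s5] s3] s8 s3i] s9].
have s3j : s 3 i <= j.
  rewrite s3i; apply: (@leq_trans (\sum_(0 <= w < j) 1)).
    by apply: leq_sum => w _; case: (_ < _).
  by rewrite sum_nat_const_nat muln1 subn0.
have s5i : s 5 i = key v := s5 v.
have s5j : s 5 j = key (mod_ord n0 j) by rewrite -(s5 (mod_ord n0 j)) /= modn_small.
have key_le x : key x <= W.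
  have fk : c x * M.+1 <= n * M.+1 by rewrite leq_mul2r; apply/orP; right; exact: ltnW.
  have fd := tuple_count_le k (edges H) (fun y => c y == t %% n) x.
  rewrite [n * _]mulnS in fk; move: fk fd; rewrite /key /refine_key.
  by move: (tuple_count _ _ _ _) (c x * M.+1) => a b; lia.
rewrite /= s8 s9 s5i s5j; split.
- by apply/andP; split; lia.
- have k1 := key_le v; have k2 := key_le (mod_ord n0 j).
  by case: (_ < _); repeat (apply/andP; split); lia.
split=> //; split=> //; last first.
  by rewrite /update !eqxx big_nat_recr //= -s3i.
split=> // x xi; rewrite /update /=; case: eqP => [E|_]; [lia|exact: s3].
Qed.

Lemma triple_refine t (c : {ffun 'I_n -> nat}) : t < n ^ 3 -> (forall v, c v < n) ->
  triple W (base t c) refine_cmd (M * (4 * p + 640))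
    (base t (refine k (edges H) c (t %% n))).
Proof.
move=> tn cn; have nM := n_le_M.
(* The quadratic ranking is absorbed into the cost of one scan of the tensor. *)
have nnM : n * n <= M by rewrite !expnS mulnA leq_pmulr // expn_gt0 n0.
have h := triple_seq (@triple_clear t c) (triple_seq (triple_count tn cn)
  (triple_seq (triple_key (t := t) cn) (triple_rank (t := t) cn))).
apply: triple_le h.
by move: nnM nM; move: M => m; nia.
Qed.

(** The diagonal pairs alone contribute [n], so any excess is a collision. *)
Lemma injectiveb_sum (c : {ffun 'I_n -> nat}) :
  injectiveb c = (\sum_v \sum_w (c v == c w) == n).
Proof.
have ge1 v : 1 <= \sum_w (c v == c w) by rewrite (bigD1 v) //= eqxx.
have := leqif_sum (fun (v : 'I_n) (_ : true) => leqif_eq (ge1 v)).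
rewrite sum_nat_const card_ord muln1 eq_sym => -[_ ->].
apply/injectiveP/forallP => [cI v|E v w cvw].
  rewrite (bigD1 v) //= eqxx big1 // => w wv.
  by case: eqP => // /cI vw; rewrite vw eqxx in wv.
apply/eqP; rewrite eq_sym; apply: contraTT (E v) => wv /=.
by rewrite (bigD1 v) //= eqxx (bigD1 w) //= cvw eqxx.
Qed.

Lemma triple_check (c : {ffun 'I_n -> nat}) : (forall v, c v < n) -> triple W
  (fun s => [/\ s 0 0 = n, s 10 0 = 0 & forall v : 'I_n, s 3 v = c v])
  check_cmd (n.+1 * (n.+1 * 60 + 60) + 20)
  (fun s => s 2 0 = injectiveb c /\ forall v : 'I_n, s 3 v = c v).
Proof.
move=> cn; have nM := n_le_M; have [W1 W2 W3] := word_bounds.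
have nnM : n * n <= M by rewrite !expnS mulnA leq_pmulr // expn_gt0 n0.
pose eqc v w : nat := c (mod_ord n0 v) == c (mod_ord n0 w).
pose f v := \sum_(0 <= w < n) eqc v w.
(* These bounds keep the accumulator at most [n^2], hence within a word. *)
have partial v j : \sum_(0 <= w < j) eqc v w <= j.
  apply: (@leq_trans (\sum_(0 <= w < j) 1)); first by apply: leq_sum => w _; exact: leq_b1.
  by rewrite sum_nat_const_nat muln1 subn0.
have partial2 i : \sum_(0 <= v < i) f v <= i * n.
  apply: (@leq_trans (\sum_(0 <= v < i) n)); first by apply: leq_sum => v _; exact: partial.
  by rewrite sum_nat_const_nat subn0.
pose I i s := [/\ s 0 0 = n, s 10 0 = \sum_(0 <= v < i) f v &
  forall v : 'I_n, s 3 v = c v].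
apply: (triple_seq (Q := I n)); last first.
  apply: triple_assign => // s [s0 s10 s3].
  have le := partial2 n; rewrite -s10 in le.
  rewrite /= s0; split=> //.
    have := leq_b1 (s 10 0 == n); move: (nat_of_bool _) => b b1.
    by repeat (apply/andP; split); lia.
  split=> //; rewrite /update /= injectiveb_sum s10 big_mkord /f; congr (nat_of_bool (_ == _)).
  apply: eq_bigr => v _; rewrite big_mkord; apply: eq_bigr => w _.
  by rewrite /eqc !mod_ord_id.
apply: (@triple_conseq W (I 0) _ (I n)) => // [s [s0 s10 s3]|].
  by split=> //; rewrite big_geq.
apply: triple_le (triple_for (T := n.+1 * 50) (N := n) (I := I) _ _ _ _ _).
- by rewrite leq_mul2l; apply/orP; right; rewrite /=; lia.
- by lia.
- by lia.
- by move=> i s [s0 _ _]; rewrite /= s0; split=> //; apply/andP; split; lia.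
- by move=> i s v.
move=> i ni; pose J j s := [/\ s 0 0 = n, s 8 0 = i,
  s 10 0 = \sum_(0 <= v < i) f v + \sum_(0 <= w < j) eqc i w &
  forall v : 'I_n, s 3 v = c v].
apply: (@triple_conseq W (J 0) _ (J n)) => [s [[s0 s10 s3] s8]|s [s0 s8 s10 s3]|].
- by split=> //; rewrite s10 [X in _ = _ + X]big_geq // addn0.
- by split=> //; split=> //; rewrite s10 big_nat_recr.
apply: triple_le (triple_for (T := 30) (N := n) (I := J) _ _ _ _ _).
- by rewrite leq_mul2l; apply/orP; right.
- by lia.
- by lia.
- by move=> j s [s0 _ _ _]; rewrite /= s0; split=> //; apply/andP; split; lia.
- by move=> j s x.
move=> j nj; apply: triple_assign => // s [[s0 s8 s10 s3] s9].
have s3i : s 3 i = c (mod_ord n0 i) by rewrite -s3 /= modn_small.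
have s3j : s 3 j = c (mod_ord n0 j) by rewrite -s3 /= modn_small.
have le1 : s 10 0 <= i * n + j by rewrite s10 leq_add.
have le2 : i * n + j < n * n by nia.
have ci := cn (mod_ord n0 i); have cj := cn (mod_ord n0 j).
rewrite /= s8 s9 s3i s3j; split=> //.
- have := leq_b1 (c (mod_ord n0 i) == c (mod_ord n0 j)); move: (nat_of_bool _) => b b1.
  by repeat (apply/andP; split); lia.
split=> //; split=> //; rewrite /update /= big_nat_recr //= addnA -s10.
by [].
Qed.

Lemma triple_refinement : triple W (fun s => s = input H) refinement_cmd
  (M * n ^ 3 * (8 * p + 2 * ecost (power_expr 3) + 2000))
  (fun s => output n s = refinement_labeler H).
Proof.
have nM := n_le_M; have [W1 W2 W3] := word_bounds.
have nnM : n * n <= M by rewrite !expnS mulnA leq_pmulr // expn_gt0 n0.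
pose X := edges H.
have cn t v : refine_iter k X t v < n.
  by apply: ranked_lt; exact: refine_iter_ranked.
pose I t s := [/\ s 0 0 = n,
  forall j, s 1 j = (j < M) && (digit_set k.+2 n j \in edges H),
  s 10 0 = 0 & forall v : 'I_n, s 3 v = refine_iter k X t v].
have n3 : 0 < n ^ 3 by rewrite expn_gt0 n0.
set p3 := ecost (power_expr 3).
apply: triple_le (triple_seq (Q := I (n ^ 3)) _ _); last first.
- apply: (triple_conseq _ _ (triple_check (cn _))) => [s []//|s [s2 s3]].
  rewrite /output /refinement_labeler s2 -/X.
  by case: injectiveb => //=; congr Some; apply/ffunP => v; rewrite ffunE.
- apply: (@triple_conseq W (I 0) _ (I (n ^ 3))) => // [s ->|].
    by split=> // v; rewrite ffunE.
  apply: (triple_for (T := M * (4 * p + 640))).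
  + by lia.
  + by lia.
  + move=> t s [s0 _ _ _]; rewrite eval_power s0; split=> //.
    by apply: fits_power => //; lia.
  + by move=> t s v.
  move=> t tn.
  apply: (triple_conseq _ _ (triple_refine tn (cn t)))
    => [s [[s0 s1 s10 s3] s6]|s [s0 s1 s6 s10 s3]].
    by split.
  by split.
rewrite -/p3; move: n3 nM nnM n0; move: M (n ^ 3) p p3 => m x q q3 *.
have : m <= m * x by rewrite leq_pmulr.
nia.
Qed.

End Program.

(** There are [n^3] rounds, each dominated by a scan of [n^(k+2)] entries, and [k + 5 <= 2 (k + 2)]
    for [k >= 1], that is for edges of size at least 3. *)
Lemma refinement_labeler_computable k : (1 <= k)%N ->
  computable_in_time (@refinement_labeler k) (fun n => (n ^ (2 * k.+2))%N).
Proof.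
move=> k1; exists (refinement_cmd k), (k + 9)%N.
eexists => n H n0.
have [|t [s' [e o le]]] := @triple_refinement k n n0 H (n.+1 ^ (k + 9)) _ _ (erefl (input H)).
  (* The word bound factors as [(n+1)^(k+3) d d] with [d = (n+1)^3 >= 8], which leaves room for the
     sum required by the program. *)
  have -> : (k + 9 = 1 + (k.+2 + 3) + 3)%N by lia.
  have b1 : (n ^ k.+2 < n.+1 ^ k.+2)%N by rewrite ltn_exp2r.
  have b2 : (n ^ 3 < n.+1 ^ 3)%N by rewrite ltn_exp2r.
  have b3 : (2 ^ 3 <= n.+1 ^ 3)%N by rewrite leq_exp2r.
  apply: (@leq_trans (n.+1 * n.+1 ^ k.+2 + n.+1 ^ 3 + 3)%N).
    by rewrite leq_add2r leq_add // ?(ltnW b2) // leq_mul2l b1 orbT.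
  have x1 : (0 < n.+1 * n.+1 ^ k.+2)%N by rewrite muln_gt0 expn_gt0.
  rewrite !expnD expn1 mulnA; move: (n.+1 * n.+1 ^ k.+2)%N (n.+1 ^ 3)%N x1 b3 => x d x1 d8.
  have d8' : (8 <= d)%N := d8.
  have h1 : (x * 8 <= x * d)%N by rewrite leq_mul2l d8' orbT.
  have h2 : (d <= x * d)%N by rewrite leq_pmull.
  have h3 : (x * d * 8 <= x * d * d)%N by rewrite leq_mul2l d8' orbT.
  by move: h1 h2 h3; move: (x * d * d)%N (x * d)%N => z y; lia.
exists t, s'; split=> //; apply: leq_trans le _.
rewrite mulnC; apply: leq_mul; first exact: leqnn.
by rewrite -expnD leq_pexp2l //; lia.
Qed.

(** * Convergence *)

Section Hypergraphs.
Variables (R : realType) (k n : nat) (p : R).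
Local Notation U := [set e : {set 'I_n} | #|e| == k].

Lemma Hnp_prob_bprob (Q : pred {set {set 'I_n}}) :
  Hnp_prob p (fun H : hypergraph k n => Q (edges H)) = bprob p U Q.
Proof.
have set0P : [forall e in (set0 : {set {set 'I_n}}), #|e| == k].
  by apply/forall_inP => e; rewrite inE.
have XU (X : {set {set 'I_n}}) : (X \subset U) = [forall e in X, #|e| == k].
  by apply/subsetP/forall_inP => h e eX; have := h e eX; rewrite inE.
rewrite /Hnp_prob /bprob.
rewrite [RHS](reindex_onto (@edges k n) (insubd (Hypergraph set0P))) /=; last first.
  by move=> X /andP[]; rewrite XU => XP _; exact: insubdK.
apply: eq_big => [H|H _].
  by rewrite valKd eqxx andbT XU edges_uniform.
by rewrite /bmass; apply: eq_bigl => e; rewrite inE.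
Qed.

Lemma Hnp_prob_ge (E : pred (hypergraph k n)) (Q : pred {set {set 'I_n}}) :
  0 <= p <= 1 -> (forall H, ~~ E H -> Q (edges H)) ->
  1 - bprob p U Q <= Hnp_prob p E <= 1.
Proof.
move=> p01 EQ; have mass0 (H : hypergraph k n) : 0 <= Hnp_mass p H.
  by apply: prodr_ge0 => e _; case: ifP => _; move/andP: p01 => []; lra.
have total : Hnp_prob p E + Hnp_prob p (predC E) = 1.
  rewrite -(sum_bmass p U); transitivity (bprob p U xpredT).
    by rewrite -Hnp_prob_bprob /Hnp_prob [RHS](bigID E).
  by apply: eq_bigl => X; rewrite andbT.
have ge0 : 0 <= Hnp_prob p (predC E) by apply: sumr_ge0 => H _; exact: mass0.
have : Hnp_prob p (predC E) <= bprob p U Q.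
  rewrite -Hnp_prob_bprob /Hnp_prob [X in X <= _]big_mkcond [X in _ <= X]big_mkcond.
  apply: ler_sum => H _; case: ifP => [/EQ->//|_]; case: ifP => // _; exact: mass0.
by lra.
Qed.

End Hypergraphs.

(** * Asymptotic estimates *)

Section Limits.
Local Open Scope classical_set_scope.
Variable R : realType.

(** The hypotheses give [b - k >= n / 16], and each factor of the falling factorial is at least
    [b - k]. *)
Lemma bin_ge_power b k n : (n <= 8 * b)%N -> (16 * k <= n)%N ->
  (n ^ k <= 'C(b, k) * (16 ^ k * k`!))%N.
Proof.
move=> nb kn; have bk j : (j <= k -> (b - k) ^ j <= b ^_ j)%N.
  elim: j => [|j IH] jk; first by rewrite expn0 ffactn0.
  by rewrite expnSr ffactnSr; apply: leq_mul; [exact: IH (ltnW jk)|lia].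
rewrite mulnCA bin_ffact; apply: leq_trans (leq_mul (leqnn _) (bk k (leqnn k))).
rewrite -expnMn; case: k kn {bk} => [|k] kn; first by rewrite !expn0.
by rewrite leq_exp2r //; lia.
Qed.

Lemma n_over_exp2 n : (2 <= n)%N -> n%:R / 2 ^+ n <= 8 / n%:R :> R.
Proof.
move=> n2; rewrite ler_pdivlMr ?ltr0n 1?ltnW // mulrAC ler_pdivrMr ?exprn_gt0 //.
rewrite -natrX -!natrM ler_nat; have := bin_le_exp2 n 2; rewrite bin2.
have := odd_double_half (n * n.-1); have := leq_b1 (odd (n * n.-1)).
have : (2 ^ 2 <= 2 ^ n)%N by rewrite leq_exp2l.
rewrite -[(2 ^ 2)%N]/4%N; move: (2 ^ n)%N (n * n.-1)./2 (nat_of_bool _) => x y z.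
by case: n n2 => // n n2 /=; nia.
Qed.

Lemma eventually_pmf_small (k : nat) (p : nat -> R) (x : R) : 0 < x ->
  (forall n, 0 <= p n <= 1) ->
  much_greater p (fun n => n%:R ^- k * ln n%:R) ->
  much_greater (fun n => 1 - p n) (fun n => n%:R ^- k * ln n%:R) ->
  \forall n \near \oo, forall b a, (n <= 8 * b)%N -> pmf 'C(b, k) (p n) a <= x.
Proof.
move=> x0 p01 hp hq; pose L := Num.bound (2 / x).
have Lx : 2 / x < L%:R by apply: archi_boundP; rewrite divr_ge0 // ltW.
have L0 : (0 < L)%N by rewrite -(ltr0n R); apply: lt_trans Lx; rewrite divr_gt0.
pose D : R := (16 ^ k * k`!)%:R.
have D0 : 0 < D by rewrite ltr0n muln_gt0 expn_gt0 fact_gt0.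
have ln2 : 0 < ln (2 : R) by rewrite ln_gt0 // ltr1n.
(* [A] is chosen so that [A <= n^k p] and [A <= n^k (1-p)] make the variance of [C(b, k)] trials at
   least [2 L^2], as [pmf_le] requires; one factor 2 pays for the larger of [p] and [1-p] being at
   least one half. *)
pose A := 4 * L%:R ^+ 2 * D.
have A0 : 0 <= A by rewrite !mulr_ge0 ?exprn_ge0 // ltW.
have big (n : nat) (r : R) : (2 <= n)%N -> A / ln 2 <= r / (n%:R ^- k * ln n%:R) ->
    A <= r * n%:R ^+ k.
  move=> n2; have n0 : 0 < n%:R :> R by rewrite ltr0n ltnW.
  have lnn : ln 2 <= ln n%:R :> R by rewrite ler_ln ?posrE // ler_nat.
  have ln0 : 0 < ln n%:R :> R by apply: lt_le_trans lnn.
  have xk : 0 < n%:R ^+ k :> R by rewrite exprn_gt0.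
  rewrite ler_pdivlMr; last by rewrite mulr_gt0 // invr_gt0.
  move=> h; rewrite -ler_pdivrMr //; apply: le_trans h.
  have -> : A / ln 2 * (n%:R ^- k * ln n%:R) = A / n%:R ^+ k * (ln n%:R / ln 2).
    by ring.
  apply: ler_peMr; first by rewrite divr_ge0 // ltW.
  by rewrite ler_pdivlMr // mul1r.
move/cvgryPge: hp => /(_ (A / ln 2)) hp; move/cvgryPge: hq => /(_ (A / ln 2)) hq.
near=> n => b a nb.
have n2 : (2 <= n)%N by near: n; exact: nbhs_infty_ge.
have nk : (16 * k <= n)%N by near: n; exact: nbhs_infty_ge.
have pA : A <= p n * n%:R ^+ k by apply: big => //; near: n; exact: hp.
have qA : A <= (1 - p n) * n%:R ^+ k by apply: big => //; near: n; exact: hq.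
apply: (@le_trans _ _ (2 / L%:R)); last first.
  by rewrite ler_pdivrMr ?ltr0n // mulrC -ler_pdivrMr // ltW.
apply: pmf_le => //; have /andP[p0 p1] := p01 n.
have NC : n%:R ^+ k <= 'C(b, k)%:R * D by rewrite -natrX -natrM ler_nat bin_ge_power.
have pq : A <= 2 * (n%:R ^+ k * (p n * (1 - p n))).
  move: (n%:R ^+ k) pA qA => y pA qA; have [ph|ph] := lerP (p n) (1 / 2); nra.
rewrite -mulrA -(ler_pM2r D0).
have : n%:R ^+ k * (p n * (1 - p n)) <= 'C(b, k)%:R * D * (p n * (1 - p n)).
  by rewrite ler_wpM2r // mulr_ge0 // subr_ge0.
by rewrite /A in pq *; lra.
Unshelve. all: by end_near.
Qed.

End Limits.

Theorem theorem2 (R : realType) (k : nat) (p : nat -> R)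
  (hk : (3 <= k)%N)
  (hp01 : forall n, 0 <= p n <= 1)
  (hp : much_greater p (fun n => n%:R ^- (k - 2) * ln n%:R))
  (hq : much_greater (fun n => 1 - p n) (fun n => n%:R ^- (k - 2) * ln n%:R)) :
  exists lab : labeler k,
    [/\ canonical_labeler lab,
        computable_in_time lab (fun n => (n ^ (2 * k))%N) &
        whp p (fun n H => lab n H != None)].
Proof.
case: k hk hp hq => [|[|k]] // hk; rewrite !subSS subn0 => hp hq.
exists (@refinement_labeler k); split.
- exact: refinement_labeler_canonical.
- exact: refinement_labeler_computable.
have x0 : 0 < (8^-1) ^+ 64 :> R by rewrite exprn_gt0 // invr_gt0.
have small := eventually_pmf_small x0 hp01 hp hq.
apply/cvgrPdist_le => e e0; near=> n.
have n100 : (100 <= n)%N by near: n; exact: nbhs_infty_ge.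
have n0 : (0 < n)%N by apply: leq_trans n100.
have ne : 8 / n%:R <= e.
  rewrite ler_pdivrMr ?ltr0n // mulrC -ler_pdivrMr //.
  apply: (@le_trans _ _ (Num.bound (8 / e))%:R).
    by rewrite ltW // archi_boundP // divr_ge0 // ltW.
  by rewrite ler_nat; near: n; exact: nbhs_infty_ge.
(* Failure leaves a non-discrete equitable partition, which has probability at most
   [n / 2^n <= 8 / n <= e]. *)
have bad : bprob (p n) [set e : {set 'I_n} | #|e| == k.+2] (@has_equitable k n) <= e.
  apply: le_trans ne; apply: le_trans (n_over_exp2 _ _); last by apply: leq_trans n100.
  by apply: bprob_has_equitable => //; near: n; exact: small.
have [] := andP (@Hnp_prob_ge R k.+2 n (p n) (fun H => refinement_labeler H != None)
  (@has_equitable k n) (hp01 n) _).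
  by move=> H; rewrite negbK => /eqP; exact: refinement_labeler_fails.
by move=> lo hi; rewrite ler_norml; lra.
Unshelve. all: by end_near.
Qed.
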